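(* Let $\lambda>0$, let $m$ be Lebesgue measure on $\mathbb{R}_+$, and let $N=(N_t,\ t\ge 0)$ be a Poisson process with intensity $\lambda m$. Let $\nu$ denote the Lévy measure of $N$. (a1) Given $a>0$, let $r^{(a)}(t):=\mathbf{1}_{[aU,\infty)}(t)$, $t\ge 0$, where $U$ is a standard uniform random variable independent of $(N_t,\ t\ge 0)$. Then $$\big(N_t+\mathbf{1}_{[aU,\infty)}(t),\ t\ge 0\big)\ \overset{(\mathrm{law})}{=}\ (N_t,\ t\ge 0)\ \text{ under }\ \mathbb{E}\Big[\frac{N_a}{\lambda a};\ \cdot\ \Big].$$ (b1) For any nonnegative random variable $Y$ whose support equals $\mathbb{R}_+$ and with $\mathbb{E}Y<\infty$, the Lévy measure $\nu$ of $(N_t,\ t\ge 0)$ can be represented as $$\nu(F)=\lambda\,\mathbb{E}\big[Y\,h(UY)\,F\big(\mathbf{1}_{[UY,\infty)}\big)\big]$$ for every measurable functional $F:\mathbb{R}_+^{[0,\infty)}\to\mathbb{R}_+$, where $U$ is a standard uniform random variable independent of $Y$ and $h(x)=1/\mathbb{P}[Y\ge x]$. In particular, if $Y$ is a standard exponential random variable independent of $U$, then $$\nu(F)=\lambda\,\mathbb{E}\big[Y e^{UY}F\big(\mathbf{1}_{[UY,\infty)}\big)\big].$$ (c1) Let $a>0$. The components of the decomposition $N\overset{(\mathrm{law})}{=}(N\,|\,N_a=0)+\mathcal{L}^{(a)}$ (with the two terms on the right independent) can be identified as $$(N_t,\ t\ge 0\ |\ N_a=0)\ \overset{(\mathrm{law})}{=}\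 (N_{t\vee a}-N_a,\ t\ge 0)\quad\text{and}\quad (\mathcal{L}^{(a)}_t,\ t\ge 0)\ \overset{(\mathrm{law})}{=}\ (N_{t\wedge a},\ t\ge 0).$$ The Lévy measures $\nu_a$ and $\tilde\nu_a$ of $(N_t,\ t\ge 0\,|\,N_a=0)$ and of $(\mathcal{L}^{(a)}_t,\ t\ge 0)$, respectively, are given by $$\nu_a(F)=\lambda\int_a^\infty F\big(\mathbf{1}_{[s,\infty)}\big)\,ds\quad\text{and}\quad \tilde\nu_a(F)=\lambda\int_0^a F\big(\mathbf{1}_{[s,\infty)}\big)\,ds$$ for every measurable functional $F:\mathbb{R}_+^{[0,\infty)}\to\mathbb{R}_+$.
   Context: A process is infinitely divisible if all its finite-dimensional marginals are infinitely divisible. For a nonnegative infinitely divisible process $\psi=(\psi(x),x\in E)$ with no drift, its Lévy measure is the unique measure $\nu$ on $\mathbb{R}_+^E$ (all functions $E\to\mathbb{R}_+$, with the cylindrical $\sigma$-algebra) such that for all $n\ge1$, $\alpha_1,\dots,\alpha_n\ge 0$, $x_1,\dots,x_n\in E$, $$\mathbb{E}\Big[e^{-\sum_{i=1}^n\alpha_i\psi(x_i)}\Big]=\exp\Big\{-\int_{\mathbb{R}_+^E}\big(1-e^{-\sum_{i=1}^n\alpha_i y(x_i)}\big)\nu(dy)\Big\},$$ and which has no mass at the zero function $0_E$ in the sense that $\nu(A)=\nu_*(A\setminus\{0_E\})$ for every cylindrical-measurable $A$, where $\nu_*$ is the inner measure. Write $\nu(F)=\int F\,d\nu$. Measurability of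 functionals is with respect to the cylindrical $\sigma$-algebra. Here $E=[0,\infty)$ and $\mathbf{1}_{[s,\infty)}$ is viewed as an element of $\mathbb{R}_+^{[0,\infty)}$. Equality in law of processes means equality of finite-dimensional distributions. For a nonnegative random variable $Z$ with $\mathbb{E}Z=1$, ''$\psi$ under $\mathbb{E}[Z;\ \cdot\ ]$'' means the law of $\psi$ under the probability measure $Z\,d\mathbb{P}$. Standard uniform means uniform on $[0,1]$; standard exponential means exponential with mean $1$. $(N\,|\,N_a=0)$ denotes a process having the conditional law of $N$ given the event $\{N_a=0\}$, and $\mathcal{L}^{(a)}$ is the nonnegative infinitely divisible process (unique in law), independent of $(N\,|\,N_a=0)$, such that $N\overset{(\mathrm{law})}{=}(N\,|\,N_a=0)+\mathcal{L}^{(a)}$. In general, for a nonnegative infinitely divisible $\psi$ without drift with Lévy measure $\nu$, the Lévy measures of $(\psi\,|\,\psi(a)=0)$ and $\mathcal{L}^{(a)}$ are $\mathbf{1}_{\{y(a)=0\}}\nu(dy)$ and $\mathbf{1}_{\{y(a)>0\}}\nu(dy)$. *)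

(* Defs.v *)
From HB Require Import structures.
From mathcomp Require Import all_boot all_order all_algebra.
From mathcomp Require Import all_classical all_reals all_analysis.

Set Implicit Arguments.
Unset Strict Implicit.
Unset Printing Implicit Defensive.

Import Order.TTheory GRing.Theory Num.Theory.
Import numFieldNormedType.Exports.

Local Open Scope classical_set_scope.
Local Open Scope ring_scope.

Definition paths (E : Type) (R : realType) : Type := E -> {nonneg R}.

HB.instance Definition _ (E : Type) (R : realType) :=
  gen_eqMixin (paths E R).
HB.instance Definition _ (E : Type) (R : realType) :=
  gen_choiceMixin (paths E R).
HB.instance Definition _ (E : Type) (R : realType) :=
  isPointed.Build (paths E R) (fun=> 0%:nng).

Definition cylinders (E : Type) (R : realType) : set (set (paths E R)) :=
  \bigcup_(t in [set: E])
    preimage_set_system setT (fun y : paths E R => (y t)%:num) measurable.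

HB.instance Definition _ (E : Type) (R : realType) :=
  @isMeasurable.Build (sigma_display (@cylinders E R)) (paths E R)
    <<s @cylinders E R >> (@sigma_algebra0 _ setT _) (@sigma_algebraC _ _)
    (@sigma_algebra_bigcup _ setT _).

Definition pzero {E : Type} {R : realType} : paths E R := fun=> 0%:nng.

Definition padd {E : Type} {R : realType} (x y : paths E R) : paths E R :=
  fun t => ((x t)%:num + (y t)%:num)%:nng.

Section process_notions.
Context {R : realType} {E : Type}.
Local Open Scope ereal_scope.

Definition fdd {T : Type} {n : nat} (psi : T -> paths E R) (t : 'I_n -> E)
    (w : T) : n.-tuple R :=
  [tuple (psi w (t i))%:num | i < n].

(* Equality in law is equality of the finite-dimensional distributions. The
   laws are taken under mu and mu', which are mere set functions so that the
   conditional and the weighted probabilities below can be used. *)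
Definition eq_law {d d' : measure_display} {T : measurableType d}
    {T' : measurableType d'} (mu : set T -> \bar R) (psi : T -> paths E R)
    (mu' : set T' -> \bar R) (psi' : T' -> paths E R) : Prop :=
  forall (n : nat) (t : 'I_n -> E) (B : set (n.-tuple R)), measurable B ->
    mu (fdd psi t @^-1` B) = mu' (fdd psi' t @^-1` B).

Definition inner_measure {d : measure_display} {T : measurableType d}
    (nu : set T -> \bar R) (A : set T) : \bar R :=
  ereal_sup [set nu B | B in [set B | measurable B /\ B `<=` A]].

(* expeR (- +oo) = 0, so that the integral may a priori be infinite. *)
Definition is_levy_measure {d : measure_display} {T : measurableType d}
    (P : probability T R) (psi : T -> paths E R)
    (nu : {measure set (paths E R) -> \bar R}) : Prop :=
  (forall (n : nat) (x : 'I_n -> E) (alpha : 'I_n -> R),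
     (forall i, 0 <= alpha i)%R ->
     'E_P[fun w => expR (- \sum_(i < n) alpha i * (psi w (x i))%:num)%R] =
     expeR (- \int[nu]_y
       (1 - expR (- \sum_(i < n) alpha i * (y (x i))%:num))%R%:E)) /\
  (forall A : set (paths E R), measurable A ->
     nu A = inner_measure nu (A `\` [set @pzero E R])).

(* psi has a Levy measure, and F |-> nu(F) is Phi for any Levy measure nu of
   psi; the choice F := \1_A shows that nu is then unique. *)
Definition levy_measure_given_by {d : measure_display} {T : measurableType d}
    (P : probability T R) (psi : T -> paths E R)
    (Phi : (paths E R -> R) -> \bar R) : Prop :=
  (exists nu : {measure set (paths E R) -> \bar R},
     is_levy_measure P psi nu) /\
  (forall nu : {measure set (paths E R) -> \bar R},
     is_levy_measure P psi nu ->
     forall F : paths E R -> R,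
       measurable_fun setT F -> (forall y, 0 <= F y)%R ->
       \int[nu]_y (F y)%:E = Phi F).

End process_notions.

Section probability_notions.
Context {R : realType}.
Local Open Scope ereal_scope.

(* Measures are total functions on [set T], unconstrained outside of the
   measurable sets: a law is only specified on the latter. *)
Definition has_law {d d' : measure_display} {T : measurableType d}
    {T' : measurableType d'} (P : probability T R) (X : T -> T')
    (mu : set T' -> \bar R) : Prop :=
  forall A : set T', measurable A -> P (X @^-1` A) = mu A.

Definition indep {d d1 d2 : measure_display} {T : measurableType d}
    {T1 : measurableType d1} {T2 : measurableType d2}
    (P : probability T R) (X : T -> T1) (Y : T -> T2) : Prop :=
  forall (A : set T1) (B : set T2), measurable A -> measurable B ->
    P (X @^-1` A `&` Y @^-1` B) = P (X @^-1` A) * P (Y @^-1` B).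

(* Taking some of the B i to be setT gives the product rule for subfamilies. *)
Definition mutually_indep {d d' : measure_display} {T : measurableType d}
    {T' : measurableType d'} (P : probability T R) (n : nat)
    (X : 'I_n -> T -> T') : Prop :=
  forall B : 'I_n -> set T', (forall i, measurable (B i)) ->
    P (\bigcap_(i in [set: 'I_n]) (X i @^-1` B i)) =
    \prod_(i < n) P (X i @^-1` B i).

Definition infinitely_divisible_law (n : nat) (mu : set (n.-tuple R) -> \bar R)
    : Prop :=
  forall k : nat, (0 < k)%N ->
    exists (d : measure_display) (T : measurableType d) (Q : probability T R)
      (X : 'I_k -> {RV Q >-> n.-tuple R}),
    [/\ mutually_indep Q (fun i => X i : T -> n.-tuple R),
        (forall i j : 'I_k, has_law Q (X i) (distribution Q (X j))) &
        has_law Q (fun w => [tuple (\sum_(i < k) tnth (X i w) j)%R | j < n]) mu].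

Definition infinitely_divisible {E : Type} {d : measure_display}
    {T : measurableType d} (P : probability T R) (psi : T -> paths E R)
    : Prop :=
  forall (n : nat) (t : 'I_n -> E),
    infinitely_divisible_law (fun B => P (fdd psi t @^-1` B)).

Definition weighted {d : measure_display} {T : measurableType d}
    (P : probability T R) (Z : T -> R) (A : set T) : \bar R :=
  \int[P]_(w in A) (Z w)%:E.

(* Only meaningful for P B > 0. *)
Definition conditional {d : measure_display} {T : measurableType d}
    (P : probability T R) (B : set T) (A : set T) : \bar R :=
  P (A `&` B) / P B.

Definition law_support {d : measure_display} {T : measurableType d}
    (P : probability T R) (Y : T -> R) : set R :=
  [set x | forall e : R, (0 < e)%R -> 0 < P (Y @^-1` ball x e)].

End probability_notions.

Section poisson_process.
Context {R : realType} {d : measure_display} {T : measurableType d}.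

(* A counting process (N-valued, null at 0, nondecreasing, right-continuous)
   with independent increments, N_t - N_s being Poisson distributed with mean
   lam * m(]s, t]). The subtractions in nat are not truncated, by
   monotonicity. *)
Record poisson_process (P : probability T R) (lam : R)
    (N : {nonneg R} -> {RV P >-> nat}) : Prop := PoissonProcess {
  pp_start : forall w : T, N 0%:nng w = 0%N ;
  pp_nondecreasing : forall (w : T) (s t : {nonneg R}),
    s <= t -> (N s w <= N t w)%N ;
  pp_right_continuous : forall (w : T) (t : {nonneg R}),
    exists2 e : R, 0 < e & forall u : {nonneg R},
      t <= u -> u%:num < t%:num + e -> N u w = N t w ;
  pp_indep : forall (n : nat) (t : nat -> {nonneg R}),
    {homo t : i j / (i <= j)%N >-> i <= j} ->
    mutually_indep P (fun (i : 'I_n) (w : T) => (N (t i.+1) w - N (t i) w)%N) ;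
  pp_increment : forall s t : {nonneg R}, s < t -> forall k : nat,
    P [set w | (N t w - N s w)%N = k] =
    (poisson_pmf
       (lam * fine (lebesgue_measure `]s%:num, t%:num]%classic)) k)%:E
}.

Implicit Type N : {nonneg R} -> T -> nat.

Definition trajectory N (w : T) : paths {nonneg R} R :=
  fun t => (N t w)%:R%:nng.

(* (N_(t \/ a) - N_a, t >= 0); no truncation for a nondecreasing N *)
Definition after N (a : {nonneg R}) : T -> paths {nonneg R} R :=
  trajectory (fun t w => (N (Num.max t a) w - N a w)%N).

Definition stopped N (a : {nonneg R}) : T -> paths {nonneg R} R :=
  trajectory (fun t w => N (Num.min t a) w).

(* M is distributed as (N | N_a = 0) under Q. *)
Definition conditioned (P : probability T R) N (a : {nonneg R})
    {d' : measure_display} {T' : measurableType d'} (Q : probability T' R)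
    (M : T' -> paths {nonneg R} R) : Prop :=
  measurable_fun setT M /\
  eq_law Q M (conditional P [set w | N a w = 0%N]) (trajectory N).

(* M and L are, under Q, the two components (N | N_a = 0) and L^(a) of the
   decomposition of N. *)
Definition decomposition (P : probability T R) N (a : {nonneg R})
    {d' : measure_display} {T' : measurableType d'} (Q : probability T' R)
    (M L : T' -> paths {nonneg R} R) : Prop :=
  [/\ conditioned P N a Q M,
      measurable_fun setT L,
      infinitely_divisible Q L,
      indep Q M L &
      eq_law P (trajectory N) Q (fun w => padd (M w) (L w))].

End poisson_process.

Definition step {R : realType} (s : R) : paths {nonneg R} R :=
  fun t => (s <= t%:num)%R%:R%:nng.

(* Main.v *)
(** The Laplace functional c |-> E e^(-<c,psi>) determines the law of a
    nonnegative process psi: the polynomials in the e^(-y(x)) approximate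
    boundedly the indicators of the sets {y(x) > b}. Applied to the densities
    1 - e^(-b y(x)), this shows that two Levy measures of psi agree on each
    {y(x) > 0}; since a measurable set of paths depends on countably many
    coordinates, the inner measure condition forces them to agree everywhere.

    For the Poisson process, the independence of (N_(t /\ a))_t and
    (N_(t \/ a) - N_a)_t yields, by induction on the number of times,
    E e^(-<c,N>) = exp(- lam \int_0^oo (1 - e^(-<c,1_[s,oo)>)) ds), so that the
    Levy measure of N is the image of lam ds by s |-> 1_[s,oo); its restrictions
    to s <= a and to s >= a belong to the stopped and to the remaining process.

    (a1) follows by differentiating E e^(-<c,N> - b N_a) at b = 0, (b1) from the
    fact that U Y is uniform on [0, Y] given Y, and the identification of L^(a)
    by cancelling in E e^(-<c,N>) the factor of (N | N_a = 0). *)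
Require Import Defs.
From HB Require Import structures.
From mathcomp Require Import all_boot all_order all_algebra.
From mathcomp Require Import all_classical all_reals all_analysis.
From mathcomp Require Import measurable_realfun ring lra zify.

Import Order.TTheory GRing.Theory Num.Theory.
Import numFieldNormedType.Exports.

Local Open Scope classical_set_scope.
Local Open Scope ring_scope.

Set Implicit Arguments.
Unset Strict Implicit.
Unset Printing Implicit Defensive.

(** * Laplace functionals on the path space *)

(** A Levy measure may have infinite mass, whereas Laplace functionals determine finite measures.
    Uniqueness is therefore proved for measures Z dmu with an integrable weight Z, and used with
    three weights: Z = 1 for laws, Z = 1 - e^(-k y(x)) for Levy measures, Z = N_a / (lam a) for
    (a1). The second is integrable because a Laplace functional is positive, which excludes an
    infinite exponent.

    The index set [0,oo) being uncountable, the singleton of the zero path is not measurable, so a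
    mass there cannot simply be subtracted. Uniqueness handles this through measurable sets that
    miss the zero path; existence, through a measurable set that misses it and carries every step
    path.

    Independent increments enter through one fact, the independence of the path stopped at a and of
    the path counted from a. It gives the Laplace functional, the effect of conditioning on N_a = 0,
    and the independence of the time windows that make the stopped process infinitely divisible. The
    factors cancelled in (c1) are Laplace functionals of probability laws, hence finite and
    nonzero. *)

Section pairing.
Context {R : realType} {E : Type}.
Implicit Types (c : seq (E * R)) (y : paths E R).

Definition pairing c y : R := \sum_(p <- c) p.2 * (y p.1)%:num.

Definition nneg_coef c := all (fun p => 0 <= p.2) c.

Lemma pairing_ge0 c y : nneg_coef c -> 0 <= pairing c y.
Proof.
rewrite /pairing; elim: c => [|p c IH] /=; first by rewrite big_nil.
by move=> /andP[p0 /IH{}IH]; rewrite big_cons addr_ge0// mulr_ge0.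
Qed.

Lemma pairing_cons p c y : pairing (p :: c) y = p.2 * (y p.1)%:num + pairing c y.
Proof. by rewrite /pairing big_cons. Qed.

Lemma pairing_padd c (x y : paths E R) :
  pairing c (padd x y) = pairing c x + pairing c y.
Proof.
by rewrite /pairing -big_split/=; apply: eq_bigr => p _; rewrite mulrDr.
Qed.

Lemma pairing_ord n (x : 'I_n -> E) (alpha : 'I_n -> R) y :
  pairing [seq (x i, alpha i) | i <- index_enum 'I_n] y =
  \sum_(i < n) alpha i * (y (x i))%:num.
Proof. by rewrite /pairing big_map. Qed.

Lemma nneg_coef_ord n (x : 'I_n -> E) (alpha : 'I_n -> R) :
  (forall i, 0 <= alpha i) ->
  nneg_coef [seq (x i, alpha i) | i <- index_enum 'I_n].
Proof. by move=> a0; rewrite /nneg_coef all_map; apply/allP => i _ /=. Qed.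

Lemma pairing_tnth c y : pairing c y =
  \sum_(i < size c)
    (tnth (in_tuple c) i).2 * (y (tnth (in_tuple c) i).1)%:num.
Proof. by rewrite /pairing big_tnth. Qed.

Lemma expR_pairing01 c y : nneg_coef c -> 0 <= expR (- pairing c y) <= 1.
Proof.
by move=> c0; rewrite expR_ge0 /= -expR0 ler_expR oppr_le0 pairing_ge0.
Qed.

End pairing.

Section path_measurability.
Context {R : realType} {E : Type}.

Lemma measurable_eval (x : E) :
  measurable_fun setT (fun y : paths E R => (y x)%:num).
Proof.
by move=> _ B mB; apply: sub_sigma_algebra; exists x => //; exists B.
Qed.

Lemma measurable_eval_gt (x : E) (b : R) :
  measurable [set y : paths E R | b < (y x)%:num].
Proof.
have -> : [set y : paths E R | b < (y x)%:num] =
    setT `&` (fun y : paths E R => (y x)%:num) @^-1` `]b, +oo[%classic.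
  by rewrite setTI; apply/seteqP; split=> y /=; rewrite in_itv/= andbT.
exact: (measurable_eval x measurableT (measurable_itv _)).
Qed.

Lemma measurable_pathsP d (T : measurableType d) (X : T -> paths E R) :
  measurable_fun setT X <->
  forall x, measurable_fun setT (fun w => (X w x)%:num).
Proof.
split=> [mX x|mX].
  exact: (measurableT_comp (measurable_eval x) mX).
apply: (@measurability _ _ _ _ setT X (@cylinders E R)) => //.
move=> _ [_ [x _ [B mB <-]] <-].
by rewrite !setTI; have := mX x measurableT B mB; rewrite setTI.
Qed.

Lemma measurable_pairing (c : seq (E * R)) : measurable_fun setT (pairing c).
Proof.
rewrite /pairing; apply: measurable_sum => p.
by apply: measurable_funM => //; exact: measurable_eval.
Qed.

Lemma measurable_expR_pairing (c : seq (E * R)) :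
  measurable_fun setT (fun y => expR (- pairing c y)).
Proof.
by apply: measurableT_comp => //; apply: measurableT_comp => //;
  exact: measurable_pairing.
Qed.

Lemma measurable_fdd d (T : measurableType d) (X : T -> paths E R) n
    (t : 'I_n -> E) :
  measurable_fun setT X -> measurable_fun setT (fdd X t).
Proof.
move=> /measurable_pathsP mX; apply/measurable_fun_tnthP => i.
have -> : (tnth (T:=R))^~ i \o fdd X t = (fun w => (X w (t i))%:num).
  by apply/funext => w /=; rewrite tnth_mktuple.
exact: mX.
Qed.

Lemma measurable_cylinder n (t : 'I_n -> E) (B : set (n.-tuple R)) :
  measurable B -> measurable (fdd id t @^-1` B : set (paths E R)).
Proof.
move=> mB; rewrite -[X in measurable X]setTI.
exact: (measurable_fdd t (@measurable_id _ (paths E R) setT) measurableT mB).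
Qed.

Lemma measurable_padd d (T : measurableType d) (X Y : T -> paths E R) :
  measurable_fun setT X -> measurable_fun setT Y ->
  measurable_fun setT (fun w => padd (X w) (Y w)).
Proof.
move=> /measurable_pathsP mX /measurable_pathsP mY.
by apply/measurable_pathsP => x /=; apply: measurable_funD.
Qed.

End path_measurability.

(** * Approximation of threshold indicators by powers of 1 - e^(-k v) *)

Section sharp.
Context {R : realType}.

(* With q = e^(-k v), (1 - q)^K is at most e^(-K q), and at least 1 - K q; the
   choice K ~ k e^(k b) makes K q large for v <= b and small for v > b. *)
Definition sharp (b : R) (k : nat) (v : R) : R :=
  (1 - expR (- (k%:R * v))) ^+ (Num.truncn (k%:R * expR (k%:R * b))).+1.

Lemma bernoulli_ineq (q : R) n : 0 <= q <= 1 -> 1 - n%:R * q <= (1 - q) ^+ n.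
Proof.
move=> /andP[q0 q1]; elim: n => [|n IH]; first by rewrite mul0r subr0 expr0.
have q1' : 0 <= 1 - q by rewrite subr_ge0.
rewrite exprS; apply: le_trans (ler_wpM2l q1' IH).
rewrite -natr1 mulrDl mul1r mulrBl mul1r mulrBr mulr1.
rewrite -subr_ge0.
have -> : 1 - n%:R * q - (q - q * (n%:R * q)) - (1 - (n%:R * q + q)) =
  q * (n%:R * q) by ring.
by rewrite mulr_ge0// mulr_ge0.
Qed.

Lemma expR_sub01 (v : R) : 0 <= v -> 0 <= 1 - expR (- v) <= 1.
Proof.
move=> v0; rewrite subr_ge0 -[leRHS]expR0 ler_expR oppr_le0 v0/=.
by rewrite lerBlDr lerDl expR_ge0.
Qed.

Lemma sharp01 b k v : 0 <= v -> 0 <= sharp b k v <= 1.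
Proof.
move=> v0; have /andP[h0 h1] : 0 <= 1 - expR (- (k%:R * v)) <= 1.
  by apply: expR_sub01; rewrite mulr_ge0.
by rewrite /sharp exprn_ge0//= exprn_ile1.
Qed.

(** The factor k in front of e^(k b) in the exponent settles the boundary case v = b: there K q is
    still at least k, so the limit is 0 and the limiting indicator is that of the strict
    inequality. *)
Lemma cvg_sharp b v : 0 <= b -> 0 <= v ->
  sharp b k v @[k --> \oo] --> ((b < v)%R%:R : R).
Proof.
move=> b0 v0; set K := fun k : nat => (Num.truncn (k%:R * expR (k%:R * b))).+1.
have K_ge k : k%:R * expR (k%:R * b) <= (K k)%:R.
  by apply/ltW; rewrite /K truncnS_gt.
have K_le k : (K k)%:R <= k%:R * expR (k%:R * b) + 1.
  by rewrite /K -natr1 lerD2r truncn_le// mulr_ge0// expR_ge0.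
have [bv|vb] := ltP b v.
  have d0 : 0 < v - b by rewrite subr_gt0.
  (* Here K q <= (k+1) e^(-k(v-b)). Halving v - b makes the exponential a square, and e^(k(v-b)/2)
     >= 1 + k(v-b)/2 >= m (k+1): one factor k+1 of the square absorbs the prefactor, the other
     leaves the rate 1/(k+1). *)
  pose m : R := Num.min 1 ((v - b) / 2).
  have m0 : 0 < m by rewrite /m lt_min ltr01 divr_gt0.
  have low k : 1 - (m ^+ 2)^-1 * (k.+1%:R)^-1 <= sharp b k v.
    apply: (@le_trans _ _ (1 - (K k)%:R * expR (- (k%:R * v)))); last first.
      apply: bernoulli_ineq; rewrite expR_ge0/= -expR0 ler_expR oppr_le0.
      by rewrite mulr_ge0.
    rewrite lerD2l lerN2.
    have Kq : (K k)%:R * expR (- (k%:R * v)) <= k.+1%:R * expR (- (k%:R * (v - b))).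
      apply: (le_trans (ler_wpM2r (expR_ge0 _) (K_le k))).
      have -> : - (k%:R * (v - b)) = k%:R * b + - (k%:R * v) by ring.
      rewrite expRD mulrA ler_wpM2r ?expR_ge0//.
      rewrite -natr1 mulrDl mul1r lerD2l -[leLHS]expR0 ler_expR.
      by rewrite mulr_ge0.
    apply: (le_trans Kq).
    rewrite expRN -invfM ler_pdivrMr ?expR_gt0//.
    rewrite mulrC ler_pdivlMr ?mulr_gt0 ?exprn_gt0//.
    rewrite mulrCA -expr2 -exprMn.
    have -> : k%:R * (v - b) = 2%:R * (k%:R * ((v - b) / 2)) by field.
    rewrite expRM_natl lerXn2r ?nnegrE ?expR_ge0//.
      by rewrite mulr_ge0// ltW.
    apply: le_trans (expR_ge1Dx _).
    rewrite -nat1r mulrDr mulr1 lerD//; first by rewrite /m ge_min lexx.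
    by rewrite mulrC ler_wpM2l// /m ge_min lexx orbT.
  apply: (@squeeze_cvgr _ _ _ _ (fun k => 1 - (m ^+ 2)^-1 * (k.+1%:R)^-1) (cst 1)).
  - near=> k; rewrite low/=.
    by have /andP[] := @sharp01 b k v v0.
  - rewrite -[X in _ --> X]subr0; apply: cvgB; first exact: cvg_cst.
    rewrite -[X in _ --> X](mulr0 (m ^+ 2)^-1); apply: cvgM; first exact: cvg_cst.
    exact: cvg_harmonic.
  - exact: cvg_cst.
have up k : sharp b k v <= expR (- k%:R).
  have q0 : 0 <= expR (- (k%:R * v)) := expR_ge0 _.
  have h : 1 - expR (- (k%:R * v)) <= expR (- expR (- (k%:R * v))).
    exact: expR_ge1Dx.
  have /andP[g0 _] : 0 <= 1 - expR (- (k%:R * v)) <= 1.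
    by apply: expR_sub01; rewrite mulr_ge0.
  apply: (@le_trans _ _ (expR (- expR (- (k%:R * v))) ^+ K k)).
    by rewrite /sharp -/(K k) lerXn2r// ?nnegrE ?expR_ge0.
  rewrite -expRM_natl ler_expR mulrN lerN2.
  apply: (le_trans _ (ler_wpM2r q0 (K_ge k))).
  rewrite -mulrA -expRD ler_peMr// -expR0 ler_expR.
  by rewrite -mulrBr mulr_ge0// subr_ge0.
apply: (@squeeze_cvgr _ _ _ _ (cst 0) (fun k : nat => expR (- k%:R))).
- near=> k; rewrite up andbT.
  by have /andP[] := @sharp01 b k v v0.
- exact: cvg_cst.
- apply: (@cvg_comp _ _ _ (fun k : nat => k%:R) (fun x => expR (- x)) _
    (pinfty_nbhs R)); first exact: cvgr_idn.
  exact: cvgr_expR.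
Unshelve. all: by end_near.
Qed.

End sharp.

Lemma integrable_mul01 {R : realType} d (T : measurableType d)
    (mu : {measure set T -> \bar R}) (Z g : T -> R) :
  mu.-integrable setT (EFin \o Z) -> measurable_fun setT g ->
  (forall w, 0 <= g w <= 1) -> mu.-integrable setT (fun w => (Z w * g w)%:E).
Proof.
move=> iZ mg g01; have /measurable_EFinP mZ := measurable_int _ iZ.
apply: (le_integrable measurableT _ _ iZ).
  by apply/measurable_EFinP/measurable_funM.
move=> w _ /=; rewrite lee_fin normrM ler_piMr//.
by have /andP[g0 g1] := g01 w; rewrite ger0_norm.
Qed.

(** * Laplace functionals determine weighted finite measures *)

Section laplace_uniqueness.
Context {R : realType} {E : Type}.
Context {d d' : measure_display} {T : measurableType d} {T' : measurableType d'}.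
Variables (mu : {measure set T -> \bar R}) (mu' : {measure set T' -> \bar R}).
Variables (Z : T -> R) (Z' : T' -> R).
Variables (X : T -> paths E R) (X' : T' -> paths E R).
Hypotheses (mX : measurable_fun setT X) (mX' : measurable_fun setT X').
Hypotheses (Z0 : forall w, 0 <= Z w) (Z'0 : forall w, 0 <= Z' w).
Hypotheses (iZ : mu.-integrable setT (EFin \o Z))
  (iZ' : mu'.-integrable setT (EFin \o Z')).
Hypothesis eqL : forall c : seq (E * R), nneg_coef c ->
  (\int[mu]_w (Z w * expR (- pairing c (X w)))%:E =
   \int[mu']_w (Z' w * expR (- pairing c (X' w)))%:E)%E.

(** Expanded, this is a signed combination of Laplace exponentials. It is kept as a product so that
    it visibly stays in [0,1], which gives integrability against the weights and the domination
    needed in the limit. *)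
Let coexp (l : seq (E * R)) (y : paths E R) : R :=
  \prod_(p <- l) (1 - expR (- (p.2 * (y p.1)%:num))).

Let measurable_coexp l : measurable_fun setT (coexp l).
Proof.
rewrite /coexp; elim: l => [|p l IH].
  by under eq_fun do rewrite big_nil; exact: measurable_cst.
under eq_fun do rewrite big_cons; apply: measurable_funM IH.
apply: measurable_funB => //; apply: measurableT_comp => //.
apply: measurableT_comp => //; apply: measurable_funM => //.
exact: measurable_eval.
Qed.

Let coexp01 l y : nneg_coef l -> 0 <= coexp l y <= 1.
Proof.
rewrite /coexp; elim: l => [|p l IH] /=; first by rewrite big_nil ler01 lexx.
move=> /andP[p0 /IH /andP[l0 l1]]; rewrite big_cons.
have /andP[q0 q1] : 0 <= 1 - expR (- (p.2 * (y p.1)%:num)) <= 1.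
  by apply: expR_sub01; rewrite mulr_ge0.
by rewrite mulr_ge0// mulr_ile1.
Qed.

Let integrable_term d0 (T0 : measurableType d0) (m : {measure set T0 -> \bar R})
    (Y : T0 -> R) (W : T0 -> paths E R) c l :
  m.-integrable setT (EFin \o Y) -> measurable_fun setT W ->
  nneg_coef c -> nneg_coef l ->
  m.-integrable setT
    (fun w => (Y w * (expR (- pairing c (W w)) * coexp l (W w)))%:E).
Proof.
move=> iY mW c0 l0; apply: integrable_mul01 => //.
  apply: measurable_funM.
    exact: (measurableT_comp (measurable_expR_pairing c)).
  exact: (measurableT_comp (measurable_coexp l)).
move=> w; have /andP[e0 e1] := expR_pairing01 (W w) c0.
by have /andP[k0 k1] := coexp01 (W w) l0; rewrite mulr_ge0// mulr_ile1.
Qed.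

Let integral_term_cons d0 (T0 : measurableType d0)
    (m : {measure set T0 -> \bar R})
    (Y : T0 -> R) (W : T0 -> paths E R) c p l :
  m.-integrable setT (EFin \o Y) -> measurable_fun setT W ->
  nneg_coef c -> nneg_coef (p :: l) ->
  (\int[m]_w (Y w * (expR (- pairing c (W w)) * coexp (p :: l) (W w)))%:E =
   \int[m]_w (Y w * (expR (- pairing c (W w)) * coexp l (W w)))%:E -
   \int[m]_w (Y w * (expR (- pairing (p :: c) (W w)) * coexp l (W w)))%:E)%E.
Proof.
move=> iY mW c0 /= /andP[p0 l0].
rewrite -integralB//; last 2 first.
- exact: integrable_term.
- by apply: integrable_term => //=; rewrite p0.
apply: eq_integral => w _; rewrite -EFinB; congr EFin.
rewrite /coexp big_cons pairing_cons opprD expRD.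
by move: (\prod_(_ <- _) _) => a; ring.
Qed.

(** Peeling the factor of [p] off the product leaves two integrals, in one of which [p] has moved
    into the exponential. The induction on [l] therefore needs [c] arbitrary; it ends at the
    hypothesis [eqL]. *)
Let eq_term c l : nneg_coef c -> nneg_coef l ->
  (\int[mu]_w (Z w * (expR (- pairing c (X w)) * coexp l (X w)))%:E =
   \int[mu']_w (Z' w * (expR (- pairing c (X' w)) * coexp l (X' w)))%:E)%E.
Proof.
elim: l c => [|p l IH] c c0 l0.
  transitivity (\int[mu]_w (Z w * expR (- pairing c (X w)))%:E)%E.
    by apply: eq_integral => w _; rewrite /coexp big_nil mulr1.
  by rewrite eqL//; apply: eq_integral => w _; rewrite /coexp big_nil mulr1.
have /= /andP[p0 l0'] := l0.
rewrite (integral_term_cons iZ mX)// (integral_term_cons iZ' mX')// !IH//=.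
by rewrite p0.
Qed.

Let sharps (l : seq (E * R)) (k : nat) (y : paths E R) : R :=
  \prod_(p <- l) sharp p.2 k (y p.1)%:num.

(** The exponent in [sharp] is an integer, so a threshold factor at x is the single factor for (x,
    k) repeated. The approximants of the indicators thus belong exactly to the class integrated by
    [eq_term]. *)
Let sharps_coexp l k : exists2 l', nneg_coef l' & forall y, sharps l k y = coexp l' y.
Proof.
elim: l => [|p l [l' l'0 IH]].
  by exists [::] => // y; rewrite /sharps /coexp !big_nil.
exists (nseq (Num.truncn (k%:R * expR (k%:R * p.2))).+1 (p.1, k%:R) ++ l').
  by rewrite /nneg_coef all_cat [X in _ && X]l'0 andbT all_nseq ler0n orbT.
move=> y; rewrite /sharps big_cons -/(sharps l k y) IH /coexp big_cat.
by congr *%R; rewrite big_nseq iter_mulr_1.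
Qed.

Let upper (l : seq (E * R)) : set (paths E R) :=
  [set y | all (fun p => p.2 < (y p.1)%:num) l].

Let cvg_sharps l y : nneg_coef l ->
  sharps l k y @[k --> \oo] --> (\1_(upper l) y : R).
Proof.
elim: l => [|p l IH] l0.
  rewrite /sharps; under eq_cvg do rewrite big_nil.
  by rewrite indicE mem_set//; exact: cvg_cst.
move: l0 => /= /andP[p0 l0].
rewrite /sharps; under eq_cvg do rewrite big_cons.
have -> : \1_(upper (p :: l)) y = (p.2 < (y p.1)%:num)%R%:R * \1_(upper l) y :> R.
  rewrite !indicE /upper -natrM mulnb; congr (_%:R); congr nat_of_bool.
  by apply/idP/andP => [/set_mem/= /andP[? ?]|[? /set_mem ?]];
    [split=> //; apply: mem_set|apply: mem_set => /=; apply/andP].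
apply: cvgM; last exact: IH.
exact: cvg_sharp.
Qed.

Let measurable_upper l : measurable (upper l).
Proof.
elim: l => [|p l IH]; first by rewrite (_ : upper [::] = setT)// -subTset.
have -> : upper (p :: l) = [set y | p.2 < (y p.1)%:num] `&` upper l.
  by apply/seteqP; split=> y /andP.
by apply: measurableI => //; exact: measurable_eval_gt.
Qed.

(** The approximants lie in [0,1], so the weight [Y] dominates; this is how its integrability
    replaces finiteness of [m]. *)
Let integral_upper d0 (T0 : measurableType d0)
    (m : {measure set T0 -> \bar R})
    (Y : T0 -> R) (W : T0 -> paths E R) l :
  (forall w, 0 <= Y w) ->
  m.-integrable setT (EFin \o Y) -> measurable_fun setT W -> nneg_coef l ->
  (\int[m]_w (Y w * sharps l k (W w))%:E @[k --> \oo] -->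
   \int[m]_(w in W @^-1` upper l) (Y w)%:E)%E.
Proof.
move=> Y0 iY mW l0; have /measurable_EFinP mY := measurable_int _ iY.
have -> : (\int[m]_(w in W @^-1` upper l) (Y w)%:E =
           \int[m]_w (Y w * \1_(upper l) (W w))%:E)%E.
  rewrite integral_mkcond; apply: eq_integral => w _.
  rewrite patchE indicE; have -> : (w \in W @^-1` upper l) = (W w \in upper l).
    by apply/idP/idP => /set_mem ?; apply: mem_set.
  by case: ifPn => _; rewrite ?mulr1 ?mulr0.
have msh k : measurable_fun setT (sharps l k).
  have [l' _ /funext ->] := sharps_coexp l k; exact: measurable_coexp.
have [] // := @dominated_convergence _ _ _ m _ measurableT
  (fun k w => (Y w * sharps l k (W w))%:E)
  (fun w => (Y w * \1_(upper l) (W w))%:E) (EFin \o Y).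
- move=> k; apply/measurable_EFinP/measurable_funM => //.
  exact: measurableT_comp (msh k) mW.
- apply/measurable_EFinP/measurable_funM => //.
  apply: measurableT_comp mW; exact: measurable_indic.
- apply: aeW => w _; apply/cvg_EFin; first by near=> k.
  by apply: cvgM; [exact: cvg_cst|exact: cvg_sharps].
- apply: aeW => w k _; have [l' l'0 ->] := sharps_coexp l k.
  have /andP[k0 k1] := coexp01 (W w) l'0.
  by rewrite /= lee_fin ger0_norm ?mulr_ge0// ler_piMr.
Unshelve. all: by end_near.
Qed.

Let eq_upper l : nneg_coef l ->
  (\int[mu]_(w in X @^-1` upper l) (Z w)%:E =
   \int[mu']_(w in X' @^-1` upper l) (Z' w)%:E)%E.
Proof.
move=> l0; have h := integral_upper Z0 iZ mX l0.
have h' := integral_upper Z'0 iZ' mX' l0.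
apply: cvg_unique h _ => //.
apply: cvg_trans h'; apply: near_eq_cvg; near=> k.
have [l' l'0 e] := sharps_coexp l k.
have e0 y : expR (- pairing [::] y) * coexp l' y = sharps l k y :> R.
  by rewrite /pairing big_nil oppr0 expR0 mul1r -e.
have := @eq_term [::] l' isT l'0.
under eq_integral do rewrite e0.
by under [in RHS]eq_integral do rewrite e0.
Unshelve. all: by end_near.
Qed.

Let cylinders_upper :
  @measurable _ (paths E R) = <<s [set upper l | l in nneg_coef] >>.
Proof.
apply/seteqP; split.
  apply: smallest_sub; first exact: smallest_sigma_algebra.
  move=> _ [x _ [B mB <-]]; rewrite setTI.
  have [s0 sC sU] := @smallest_sigma_algebra _ setT [set upper l | l in nneg_coef].
  pose F := [set A : set R |
    <<s [set upper l | l in nneg_coef] >> ((fun y : paths E R => (y x)%:num) @^-1` A)].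
  suff : <<s [set `]b, +oo[%classic | b in [set: R]] >> `<=` F.
    apply; have : (@ocitv R).-sigma.-measurable B := mB.
    rewrite RGenOInfty.measurableE; apply: sub_sigma_algebra2.
    by move=> A [b ->]; exists b.
  apply: smallest_sub.
    split; rewrite /F /=.
    - by rewrite preimage_set0; apply: s0.
    - by move=> A; rewrite setTD preimage_setC -setTD; exact: sC.
    - by move=> A h; rewrite preimage_bigcup; exact: sU.
  move=> _ [b _ <-]; rewrite /F /=.
  have [b0|b0] := leP 0 b.
    apply: sub_sigma_algebra; exists [:: (x, b)] => /=; first by rewrite b0.
    by apply/seteqP; split=> y; rewrite /upper /= in_itv/= !andbT.
  (* Thresholds in [upper] are nonnegative, as [cvg_sharp] requires; since coordinates are
     nonnegative, a negative threshold imposes no condition and is rendered by the empty list. *)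
  have -> : (fun y : paths E R => (y x)%:num) @^-1` `]b, +oo[ = upper [::].
    apply/seteqP; split=> y //= _; rewrite in_itv/= andbT.
    exact: lt_le_trans b0 _.
  by apply: sub_sigma_algebra; exists [::].
apply: smallest_sub; first exact: smallest_sigma_algebra.
by move=> _ [l _ <-]; exact: measurable_upper.
Qed.

Let fin_int d0 (T0 : measurableType d0)
    (m : {measure set T0 -> \bar R}) (Y : T0 -> R) (W : T0 -> paths E R) S :
  m.-integrable setT (EFin \o Y) -> measurable_fun setT W -> measurable S ->
  (\int[m]_(w in W @^-1` (~` S)) (Y w)%:E =
   \int[m]_w (Y w)%:E - \int[m]_(w in W @^-1` S) (Y w)%:E)%E.
Proof.
move=> iY mW mS.
have mWS : measurable (W @^-1` S) by rewrite -[X in measurable X]setTI; exact: mW.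
rewrite -(setUv (W @^-1` S)) integral_setU//.
- rewrite preimage_setC addeAC subee ?add0e//.
  apply: (integrable_fin_num mWS).
  exact: integrableS iY.
- exact: measurableC.
- by rewrite setUv; exact: measurable_int iY.
- exact/disj_setPCl.
Qed.

(* Polynomials in the e^(-y(x)) are integrated the same way on both sides, and
   they approximate boundedly the indicators of the sets {y(x_i) > b_i}, which
   form a pi-system generating the cylindrical sigma-algebra. *)
Lemma laplace_unique A : measurable A ->
  (\int[mu]_(w in X @^-1` A) (Z w)%:E = \int[mu']_(w in X' @^-1` A) (Z' w)%:E)%E.
Proof.
have eqT : (\int[mu]_w (Z w)%:E = \int[mu']_w (Z' w)%:E)%E.
  have upper0 : upper [::] = setT by rewrite -subTset.
  by have := @eq_upper [::] isT; rewrite upper0 !preimage_setT.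
rewrite cylinders_upper.
apply: (@dynkin_induction _ _ _ (fun B : set (paths E R) =>
  \int[mu]_(w in X @^-1` B) (Z w)%:E =
  \int[mu']_(w in X' @^-1` B) (Z' w)%:E)%E cylinders_upper).
- move=> _ _ [l l0 <-] [l' l'0 <-]; exists (l ++ l').
    by rewrite /nneg_coef all_cat; apply/andP.
  apply/seteqP; split=> y; rewrite /upper /= all_cat => /andP //.
- by rewrite !preimage_setT.
- by move=> _ [l l0 <-]; exact: eq_upper.
- by move=> S mS eS; rewrite fin_int// eqT eS -fin_int.
- move=> F mF tF eF; rewrite !preimage_bigcup.
  have tP d0 (T0 : measurableType d0) (W : T0 -> paths E R) :
      trivIset setT (fun n => W @^-1` F n).
    apply/trivIsetP => i j _ _ ij; rewrite -preimage_setI.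
    by move/trivIsetP : tF => /(_ _ _ _ _ ij) ->//; rewrite preimage_set0.
  have mP d0 (T0 : measurableType d0) (W : T0 -> paths E R) k :
      measurable_fun setT W -> measurable (W @^-1` F k).
    by move=> mW; rewrite -[X in measurable X]setTI; exact: mW.
  rewrite (ge0_integral_bigcup mu (fun k => mP _ _ X k mX)); last 3 first.
  - by apply: measurable_funTS; exact: measurable_int iZ.
  - by move=> w _; rewrite lee_fin.
  - exact: tP.
  rewrite (ge0_integral_bigcup mu' (fun k => mP _ _ X' k mX')); last 3 first.
  - by apply: measurable_funTS; exact: measurable_int iZ'.
  - by move=> w _; rewrite lee_fin.
  - exact: tP.
  by apply: eq_eseriesr => i _; exact: eF.
Qed.

End laplace_uniqueness.

(** * Uniqueness of the Levy measure *)

Lemma cvg_natM_pinfty {R : realType} (v : R) : 0 < v ->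
  k%:R * v @[k --> \oo] --> +oo.
Proof.
move=> v0; apply: (@cvg_comp _ _ _ (fun k : nat => k%:R : R) (fun r => r * v)
  _ (pinfty_nbhs R)); first exact: cvgr_idn.
by apply: gt0_cvgMly => //; exact: cvg_id.
Qed.

Section countable_coordinates.
Context {R : realType} {E : Type}.

Definition determined_by (c : nat -> E) (A : set (paths E R)) :=
  forall y z : paths E R, (forall n, y (c n) = z (c n)) -> A y -> A z.

(** The sets determined by some sequence of coordinates form a sigma-algebra: the property is
    symmetric in the two paths, hence passes to complements, and countably many sequences merge into
    one. Each cylinder is determined by a constant sequence. *)
Lemma measurable_determined (x0 : E) (A : set (paths E R)) : measurable A ->
  exists c : nat -> E, determined_by c A.
Proof.
suff : <<s @cylinders E R >> `<=` [set A | exists c, determined_by c A].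
  by apply.
apply: smallest_sub.
  split.
  - by exists (fun=> x0) => y z _.
  - move=> B [c cB]; exists c => y z yz [_ By]; split=> // Bz; apply: By.
    by apply: cB Bz => n; rewrite yz.
  - move=> B /choice[c cB].
    (* The sequences are merged along a coding of pairs (set, position) by integers; [x0] fills the
       integers that code no pair. *)
    exists (fun n => if unpickle n is Some ij then c ij.1 ij.2 else x0).
    move=> y z yz [i _ Biy]; exists i => //.
    by apply: cB Biy => n; have := yz (pickle (i, n)); rewrite pickleK.
move=> _ [x _ [B mB <-]]; exists (fun=> x) => y z yz.
by rewrite !setTI /= (yz 0%N).
Qed.

End countable_coordinates.

Section levy_uniqueness.
Context {R : realType} {E : Type} {d : measure_display} {T : measurableType d}.
Variables (P : probability T R) (psi : T -> paths E R).
Hypothesis mpsi : measurable_fun setT psi.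
Implicit Type nu : {measure set (paths E R) -> \bar R}.

Lemma levy_laplace nu c : is_levy_measure P psi nu -> nneg_coef c ->
  ('E_P[fun w => expR (- pairing c (psi w))] =
   expeR (- \int[nu]_y (1 - expR (- pairing c y))%:E))%E.
Proof.
move=> [+ _] c0 => /(_ _ (fun i => (tnth (in_tuple c) i).1)
  (fun i => (tnth (in_tuple c) i).2)) levy.
under eq_fun do rewrite pairing_tnth.
rewrite levy; last first.
  by move=> i; rewrite (tnth_nth (tnth (in_tuple c) i)); apply: (all_nthP _ c0).
by congr (expeR (- _))%E; apply: eq_integral => y _; rewrite pairing_tnth.
Qed.

(** A positive integrand with zero integral would make the whole space negligible. Strict positivity
    serves twice: it excludes an infinite exponent in the Levy formula, and it allows a Laplace
    factor to be cancelled. *)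
Lemma laplace_gt0 (c : seq (E * R)) : nneg_coef c ->
  (0 < 'E_P[fun w => expR (- pairing c (psi w))])%E.
Proof.
move=> c0; rewrite unlock.
have mf : measurable_fun setT (fun w => (expR (- pairing c (psi w)))%:E).
  apply/measurable_EFinP.
  exact: (measurableT_comp (measurable_expR_pairing c)).
rewrite lt_def integral_ge0 ?andbT => [|w _]; last by rewrite lee_fin expR_ge0.
apply/eqP => int0.
have /ae_eq_integral_abs : measurable_fun [set: T]
  (fun w => (expR (- pairing c (psi w)))%:E) by [].
move=> /(_ P measurableT)[+ _]; rewrite /ae_eq.
under eq_integral do rewrite gee0_abs ?lee_fin ?expR_ge0//.
move=> /(_ int0) ae0.
have negT : P.-negligible setT.
  apply: negligibleS ae0 => w _ /= /(_ I) [] /eqP.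
  by rewrite gt_eqF// expR_gt0.
have : P [set: T] = 0%E := measure_negligible measurableT negT.
by rewrite probability_setT => /eqP; rewrite onee_eq0.
Qed.

(** An infinite integral would give [expeR] the value 0 at -oo, against the positivity of the
    Laplace functional. These functions are thus admissible weights even when [nu] is infinite. *)
Lemma levy_integrable nu c : is_levy_measure P psi nu -> nneg_coef c ->
  nu.-integrable setT (fun y => (1 - expR (- pairing c y))%:E).
Proof.
move=> levy c0; have := laplace_gt0 c0; rewrite (levy_laplace levy)//.
rewrite lt_neqAle eq_sym expeR_eq0 eqe_oppLR expeR_ge0 andbT => nooo.
apply/integrableP; split.
  apply/measurable_EFinP; apply: measurable_funB => //.
  exact: measurable_expR_pairing.
under eq_integral => y _.
  rewrite gee0_abs; last first.
    by rewrite lee_fin; have /andP[] := expR_sub01 (pairing_ge0 y c0).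
  over.
by rewrite ltey.
Qed.

Lemma levy_laplace_inj nu nu' c :
  is_levy_measure P psi nu -> is_levy_measure P psi nu' -> nneg_coef c ->
  (\int[nu]_y (1 - expR (- pairing c y))%:E =
   \int[nu']_y (1 - expR (- pairing c y))%:E)%E.
Proof.
move=> levy levy' c0; have := levy_laplace levy c0.
by rewrite (levy_laplace levy' c0) => /expeR_inj/oppe_inj.
Qed.

(** The weight telescopes: (1 - e^(-b y(x))) e^(-<c,y>) is the difference of two integrands of the
    Levy formula. The Laplace functional of the weighted measure is therefore determined by the law
    of [psi]. *)
Lemma levy_weighted_laplace nu (x : E) (b : R) c :
  0 <= b -> nneg_coef c -> is_levy_measure P psi nu ->
  (\int[nu]_y ((1 - expR (- (b * (y x)%:num))) * expR (- pairing c y))%:E =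
   \int[nu]_y (1 - expR (- pairing ((x, b) :: c) y))%:E -
   \int[nu]_y (1 - expR (- pairing c y))%:E)%E.
Proof.
move=> b0 c0 levy; rewrite -integralB//; last 2 first.
- by apply: levy_integrable => //=; rewrite b0.
- exact: levy_integrable.
apply: eq_integral => y _; rewrite -EFinB; congr EFin.
by rewrite pairing_cons opprD expRD /=; ring.
Qed.

Lemma levy_eq_pos nu nu' (x : E) (A : set (paths E R)) : measurable A ->
  is_levy_measure P psi nu -> is_levy_measure P psi nu' ->
  nu (A `&` [set y | 0 < (y x)%:num]) = nu' (A `&` [set y | 0 < (y x)%:num]).
Proof.
move=> mA levy levy'.
pose g (k : nat) (y : paths E R) := 1 - expR (- (k%:R * (y x)%:num)).
have gE k y : g k y = 1 - expR (- pairing [:: (x, k%:R)] y).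
  by rewrite /g pairing_cons /pairing big_nil addr0.
have mg k : measurable_fun setT (g k).
  rewrite (_ : g k = fun y => 1 - expR (- pairing [:: (x, k%:R)] y)).
    by apply: measurable_funB => //; exact: measurable_expR_pairing.
  by apply/funext => y; rewrite gE.
have g0 k y : 0 <= g k y.
  by have /andP[] : 0 <= g k y <= 1 by apply: expR_sub01; rewrite mulr_ge0.
have mpos := @measurable_eval_gt R E x 0.
have eqg k : (\int[nu]_(y in A) (g k y)%:E = \int[nu']_(y in A) (g k y)%:E)%E.
  have ig m : is_levy_measure P psi m -> m.-integrable setT (EFin \o g k).
    move=> lm; have := @levy_integrable m [:: (x, k%:R)] lm.
    rewrite /= ler0n => /(_ isT).
    by apply: eq_integrable => // y _ /=; rewrite gE.
  apply: (@laplace_unique _ _ _ _ _ _ nu nu' (g k) (g k) id id) => //.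
  - exact: ig.
  - exact: ig.
  - move=> c c0; have k0 : 0 <= k%:R :> R by [].
    rewrite (levy_weighted_laplace _ k0)// (levy_weighted_laplace _ k0)//.
    by congr (_ - _)%E; apply: levy_laplace_inj => //=; rewrite k0.
(* The weights increase with k to the indicator of {y(x) > 0}. Convergence is by monotonicity, since
   that set may have infinite measure and no integrable bound is at hand. *)
have cvg_g (m : {measure set (paths E R) -> \bar R}) :
    (\int[m]_(y in A) (g k y)%:E @[k --> \oo] -->
     m (A `&` [set y | (0 < (y x)%:num)%R]))%E.
  have -> : m (A `&` [set y | 0 < (y x)%:num]) =
      (\int[m]_(y in A) limn (fun k => (g k y)%:E))%E.
    rewrite setIC -integral_indic//; apply: eq_integral => y _.
    apply/esym/cvg_lim => //; apply/cvg_EFin; first by near=> k.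
    rewrite indicE; have [y0|y0] := ltP 0 (y x)%:num.
      rewrite mem_set// -[X in _ --> X](subr0 1); apply: cvgB; first exact: cvg_cst.
      apply: (@cvg_comp _ _ _ (fun k : nat => k%:R * (y x)%:num)
        (fun v => expR (- v)) _ (pinfty_nbhs R)).
        exact: cvg_natM_pinfty.
      exact: cvgr_expR.
    rewrite memNset/=; last by apply/negP; rewrite -leNgt.
    have -> : fine \o (fun k => (g k y)%:E) = cst 0; last exact: cvg_cst.
    apply/funext => k; rewrite /g /=.
    have -> : (y x)%:num = 0 by apply/eqP; rewrite eq_le y0 /=.
    by rewrite mulr0 oppr0 expR0 subrr.
  apply: cvg_monotone_convergence => //.
  - by move=> k; apply/measurable_EFinP/measurable_funTS.
  - by move=> k y _; rewrite lee_fin.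
  - move=> y _ k k' kk'; rewrite lee_fin lerD2l lerN2 ler_expR lerN2.
    by rewrite ler_wpM2r// ler_nat.
apply: (@cvg_unique _ _ _ _ _ _ (cvg_g nu)) => //.
by apply: cvg_trans (cvg_g nu'); apply: near_eq_cvg; near=> k.
Unshelve. all: by end_near.
Qed.

(** If [c] determines B, a path of B vanishing along [c] would force the zero path into B. Hence B
    is covered by the sets {y(c n) > 0}; made disjoint, each piece falls under [levy_eq_pos]. *)
Lemma levy_eq_off0 (x0 : E) nu nu' (B : set (paths E R)) : measurable B ->
  ~ B pzero -> is_levy_measure P psi nu -> is_levy_measure P psi nu' ->
  nu B = nu' B.
Proof.
move=> mB B0 levy levy'; have [c cB] := measurable_determined x0 mB.
pose D n := B `&` [set y | 0 < (y (c n))%:num].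
have mD n : measurable (D n).
  by apply: measurableI => //; exact: measurable_eval_gt.
have mS n : measurable (seqDU D n).
  by apply: measurableD => //; apply: bigsetU_measurable.
have -> : B = \bigcup_n seqDU D n.
  rewrite -seqDU_bigcup_eq; apply/seteqP; split=> [y By|y [n _ []//]].
  apply: contrapT => yD; apply: B0; apply: (cB y) => // n.
  apply/val_inj => /=; apply/eqP; rewrite eq_le ge0 andbT leNgt; apply/negP => yn.
  by apply: yD; exists n.
rewrite !measure_bigcup//=.
apply: eq_eseriesr => n _.
have -> : seqDU D n = seqDU D n `&` [set y | 0 < (y (c n))%:num].
  by apply/seteqP; split=> [y [[By y0] yD]|y []//]; split=> //; split.
exact: levy_eq_pos.
Qed.

(** Every measurable set competing in the inner measure of A minus the zero path misses that path,
    so [levy_eq_off0] applies to it and both suprema range over the same values. *)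
Lemma levy_measure_unique (x0 : E) nu nu' A :
  is_levy_measure P psi nu -> is_levy_measure P psi nu' ->
  measurable A -> nu A = nu' A.
Proof.
move=> levy levy' mA; rewrite levy.2// levy'.2//; congr ereal_sup.
have sub m m' : is_levy_measure P psi m -> is_levy_measure P psi m' ->
  [set m B | B in [set B | measurable B /\ B `<=` A `\ pzero]] `<=`
  [set m' B | B in [set B | measurable B /\ B `<=` A `\ pzero]].
  move=> lm lm' _ [B [mB BA] <-]; exists B => //.
  by apply: (levy_eq_off0 x0) => // B0; have [_ nz] := BA _ B0; exact: nz.
by apply/seteqP; split; apply: sub.
Qed.

Lemma levy_measure_given_byP (x0 : E) nu Phi : is_levy_measure P psi nu ->
  (forall F : paths E R -> R, measurable_fun setT F -> (forall y, 0 <= F y) ->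
    (\int[nu]_y (F y)%:E = Phi F)%E) ->
  levy_measure_given_by P psi Phi.
Proof.
move=> levy nuF; split; first by exists nu.
move=> nu' levy' F mF F0; rewrite -nuF//; apply: eq_measure_integral => A mA _.
exact: (levy_measure_unique x0).
Qed.

End levy_uniqueness.

(** * Levy measures carried by the step paths *)

Lemma integral_mrestr d (T : measurableType d) (R : realType)
    (mu : {measure set T -> \bar R}) (D : set T) (mD : measurable D)
    (f : T -> \bar R) :
  measurable_fun setT f -> (forall x, (0 <= f x)%E) ->
  (\int[mrestr mu mD]_x f x = \int[mu]_(x in D) f x)%E.
Proof.
move=> mf f0; rewrite -(setUv D) ge0_integral_setU//; last 3 first.
- exact: measurableC.
- by rewrite setUv.
- exact/disj_setPCl.
rewrite [X in (_ + X)%E](_ : _ = 0%E) ?adde0.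
  apply: eq_measure_integral => A mA AD.
  by rewrite /= /mrestr setIidl.
rewrite -(@integral_measure_zero _ _ R (~` D) f); apply: eq_measure_integral => A mA AD.
by rewrite /= /mrestr (_ : A `&` D = set0) ?measure0//; apply/disjoints_subset.
Qed.

Section step_measure.
Context {R : realType}.
Implicit Types (D : set (measurableTypeR R)) (l : {nonneg R}).

Lemma measurable_step :
  measurable_fun setT (@step R : measurableTypeR R -> paths {nonneg R} R).
Proof.
apply/measurable_pathsP => x.
have -> : (fun s : measurableTypeR R => (step s x)%:num) = \1_(`]-oo, x%:num]).
  by apply/funext => s /=; rewrite indicE mem_setE in_itv.
exact: measurable_indic.
Qed.

(** One construction serves three Levy measures: D is ]0,+oo[ for N, [0,a] for the stopped process,
    and [a,+oo[ for the process conditioned on N_a = 0. *)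
Definition step_measure l D (mD : measurable D) :
    set (paths {nonneg R} R) -> \bar R :=
  pushforward (mscale l (mrestr lebesgue_measure mD)) step.

Let pushforward_step (m : {measure set (measurableTypeR R) -> \bar R}) :
  {measure set (paths {nonneg R} R) -> \bar R} :=
  measure_function_pushforward__canonical__measure_function_Measure m measurable_step.

HB.instance Definition _ l D (mD : measurable D) :=
  isMeasure.Build _ _ _ (step_measure l mD)
    (@measure0 _ _ _ (pushforward_step (mscale l (mrestr lebesgue_measure mD))))
    (@measure_ge0 _ _ _ (pushforward_step (mscale l (mrestr lebesgue_measure mD))))
    (@measure_semi_sigma_additive _ _ _
      (pushforward_step (mscale l (mrestr lebesgue_measure mD)))).

Lemma integral_step_measure l D (mD : measurable D)
    (f : paths {nonneg R} R -> \bar R) :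
  measurable_fun setT f -> (forall y, (0 <= f y)%E) ->
  (\int[step_measure l mD]_y f y =
   l%:num%:E * \int[lebesgue_measure]_(s in D) f (step s))%E.
Proof.
move=> mf f0; rewrite ge0_integral_pushforward//; last exact: measurable_step.
have mfs : measurable_fun setT (f \o step : measurableTypeR R -> \bar R).
  exact: measurableT_comp mf measurable_step.
by rewrite preimage_setT ge0_integral_mscale ?integral_mrestr// => x *; exact: f0.
Qed.

(** The set V of paths positive at some integer time is measurable, misses the zero path and
    contains every step path, which equals 1 at each integer beyond its jump. Hence A intersected
    with V attains the supremum. *)
Lemma step_measure_inner l D (mD : measurable D) (A : set (paths {nonneg R} R)) :
  measurable A ->
  step_measure l mD A = inner_measure (step_measure l mD) (A `\` [set pzero]).
Proof.
move=> mA; pose c n : {nonneg R} := NngNum (ler0n R n).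
pose V := \bigcup_n [set y : paths {nonneg R} R | 0 < (y (c n))%:num].
have mV : measurable V by apply: bigcup_measurable => n _; exact: measurable_eval_gt.
apply/eqP; rewrite eq_le; apply/andP; split; last first.
  apply: ge_ereal_sup => _ [B [mB BA] <-]; apply: le_measure; rewrite ?inE//.
  by apply: (subset_trans BA); exact: subDsetl.
apply: ereal_sup_ge; exists (step_measure l mD (A `&` V)).
  exists (A `&` V) => //; split; first exact: measurableI.
  move=> y [Ay [n _ yn]]; split=> // y0; move: yn; rewrite /= y0 /=.
  by rewrite ltxx.
rewrite (measureDI _ mA mV) [X in (X + _)%E](_ : _ = 0%E) ?add0e//.
have stepV0 : (@step R) @^-1` (A `\` V) = set0.
  rewrite -subset0 => s /= [_ Vs]; apply: Vs.
  exists (Num.truncn s).+1 => //=.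
  by rewrite ltr0n lt0b; apply/ltW; rewrite truncnS_gt.
exact: etrans (congr1 (mscale l (mrestr lebesgue_measure mD)) stepV0) (measure0 _).
Qed.

Lemma step_levy_measure d (T : measurableType d) (P : probability T R)
    (psi : T -> paths {nonneg R} R) l D (mD : measurable D) :
  (forall c : seq ({nonneg R} * R), nneg_coef c ->
    'E_P[fun w => expR (- pairing c (psi w))] =
    expeR (- (l%:num%:E * \int[lebesgue_measure]_(s in D)
      (1 - expR (- pairing c (step s)))%:E)))%E ->
  is_levy_measure P psi (step_measure l mD).
Proof.
move=> psiL; split; last exact: step_measure_inner.
move=> n x alpha alpha0.
under eq_fun do rewrite -pairing_ord.
under [in RHS]eq_integral do rewrite -pairing_ord.
rewrite psiL ?nneg_coef_ord// integral_step_measure//.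
  apply/measurable_EFinP/measurable_funB => //; exact: measurable_expR_pairing.
move=> y; rewrite lee_fin.
by have /andP[] := expR_sub01 (pairing_ge0 y (nneg_coef_ord x alpha0)).
Qed.

Lemma step_levy_measure_given_by d (T : measurableType d) (P : probability T R)
    (psi : T -> paths {nonneg R} R) l D :
  measurable_fun setT psi -> measurable D ->
  (forall c : seq ({nonneg R} * R), nneg_coef c ->
    'E_P[fun w => expR (- pairing c (psi w))] =
    expeR (- (l%:num%:E * \int[lebesgue_measure]_(s in D)
      (1 - expR (- pairing c (step s)))%:E)))%E ->
  levy_measure_given_by P psi (fun F =>
    l%:num%:E * \int[lebesgue_measure]_(s in D) (F (step s))%:E)%E.
Proof.
move=> mpsi mD psiL.
apply: (levy_measure_given_byP mpsi 0%:nng (step_levy_measure mD psiL)) => F mF F0.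
by rewrite integral_step_measure//; exact/measurable_EFinP.
Qed.

End step_measure.

(** * Independence of the Poisson process before and after a time *)

Section independence.
Context {R : realType} {d : measure_display} {T : measurableType d}.
Variable P : probability T R.

Lemma indep_integral d1 d2 (T1 : measurableType d1) (T2 : measurableType d2)
    (X : T -> T1) (Y : T -> T2) (f : T1 * T2 -> \bar R) :
  measurable_fun setT X -> measurable_fun setT Y -> indep P X Y ->
  measurable_fun setT f -> (forall z, (0 <= f z)%E) ->
  (\int[P]_w f (X w, Y w) = \int[P]_w \int[P]_w' f (X w, Y w'))%E.
Proof.
move=> mX mY XY mf f0.
pose X' : {RV P >-> T1} := HB.pack X (isMeasurableFun.Build _ _ _ _ X mX).
pose Y' : {RV P >-> T2} := HB.pack Y (isMeasurableFun.Build _ _ _ _ Y mY).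
have mXY : measurable_fun setT (fun w => (X w, Y w)).
  exact/measurable_fun_pairP.
pose XY' : {RV P >-> (T1 * T2)%type} :=
  HB.pack (fun w => (X w, Y w)) (isMeasurableFun.Build _ _ _ _ _ mXY).
transitivity (\int[distribution P XY']_z f z)%E.
  by rewrite ge0_integral_distribution.
transitivity (\int[distribution P X' \x distribution P Y']_z f z)%E.
  apply: eq_measure_integral => A mA _; exact/esym/product_measure_unique.
rewrite fubini_tonelli1// ge0_integral_distribution//; last first.
- by move=> x; apply: integral_ge0.
- exact: measurable_fun_fubini_tonelli_F.
apply: eq_integral => w _; rewrite /= /fubini_F ge0_integral_distribution//.
exact: (measurableT_comp mf (pair1_measurable _)).
Qed.

Lemma indep_integralM d1 d2 (T1 : measurableType d1) (T2 : measurableType d2)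
    (X : T -> T1) (Y : T -> T2) (f : T1 -> R) (g : T2 -> R) :
  measurable_fun setT X -> measurable_fun setT Y -> indep P X Y ->
  measurable_fun setT f -> (forall x, 0 <= f x) ->
  measurable_fun setT g -> (forall x, 0 <= g x) ->
  (\int[P]_w (f (X w) * g (Y w))%:E =
   \int[P]_w (f (X w))%:E * \int[P]_w (g (Y w))%:E)%E.
Proof.
move=> mX mY XY mf f0 mg g0.
rewrite (@indep_integral _ _ _ _ X Y (fun z => (f z.1 * g z.2)%:E))//; last 2 first.
- apply/measurable_EFinP/measurable_funM.
    exact: measurableT_comp mf measurable_fst.
  exact: measurableT_comp mg measurable_snd.
- by move=> z; rewrite lee_fin mulr_ge0.
have mgY : measurable_fun setT (fun w => (g (Y w))%:E).
  by apply/measurable_EFinP; exact: measurableT_comp mg mY.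
have mfX : measurable_fun setT (fun w => (f (X w))%:E).
  by apply/measurable_EFinP; exact: measurableT_comp mf mX.
rewrite -ge0_integralZr//; last 2 first.
- by move=> w _; rewrite lee_fin.
- by apply: integral_ge0 => w _; rewrite lee_fin.
apply: eq_integral => w _ /=; rewrite -ge0_integralZl//.
- by move=> w' _; rewrite lee_fin.
- by rewrite lee_fin.
Qed.

Lemma dynkin_indep (B : set T) : measurable B ->
  dynkin [set A | measurable A /\ P (A `&` B) = (P A * P B)%E].
Proof.
move=> mB; split=> /=.
- by split=> //; rewrite setTI probability_setT mul1e.
- move=> A [mA AB]; split; first exact: measurableC.
  have -> : ~` A `&` B = B `\` A by rewrite setIC.
  have -> : P (B `\` A) = (P B - P (A `&` B))%E.
    rewrite setIC; apply: measureD => //.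
    by rewrite (le_lt_trans (probability_le1 P mB)) ?ltry.
  rewrite AB probability_setC// muleBl ?mul1e//.
  exact: fin_num_measure.
- move=> F tF mF; split; first by apply: bigcup_measurable => k _; case: (mF k).
  rewrite setI_bigcupl measure_bigcup//=; last 2 first.
    by move=> k _; apply: measurableI => //; case: (mF k).
    by apply: trivIset_setIr.
  rewrite measure_bigcup//=; last by move=> k _; case: (mF k).
  have -> : P B = (fine (P B))%:E by rewrite fineK// fin_num_measure.
  rewrite muleC -nneseriesZl//; apply: eq_eseriesr => k _.
  by case: (mF k) => _ ->; rewrite fineK ?fin_num_measure// muleC.
Qed.

(** Two Dynkin arguments: with B fixed in H, the product rule extends from G to the sigma-algebra it
    generates; with A then fixed in the latter, it extends from H. *)
Lemma pi_system_indep (G H : set (set T)) :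
  setI_closed G -> setI_closed H ->
  G `<=` measurable -> H `<=` measurable ->
  (forall A B, G A -> H B -> P (A `&` B) = (P A * P B)%E) ->
  forall A B, <<s G >> A -> <<s H >> B -> P (A `&` B) = (P A * P B)%E.
Proof.
move=> GI HI mG mH GH.
have sGH A B : <<s G >> A -> H B -> measurable A /\ P (A `&` B) = (P A * P B)%E.
  rewrite -(setI_closed_g_dynkin_g_sigma_algebra GI) => + HB.
  move: A; apply: smallest_sub; first by apply: dynkin_indep; exact: mH.
  by move=> A GA; split; [exact: mG|exact: GH].
move=> A B sA; rewrite -(setI_closed_g_dynkin_g_sigma_algebra HI).
have mA : measurable A.
  move: A sA; apply: smallest_sub; last exact: mG.
  exact: sigma_algebra_measurable.
suff : <<d H >> `<=` [set B | measurable B /\ P (B `&` A) = (P B * P A)%E].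
  by move=> /[apply] -[_]; rewrite setIC muleC.
apply: smallest_sub; first exact: dynkin_indep.
move=> {}B HB; split; first exact: mH.
by rewrite setIC muleC; case: (sGH A B sA HB).
Qed.

End independence.

Lemma measurable_fun_nat d (T : measurableType d) (f : T -> nat) :
  (forall k, measurable [set w | f w = k]) -> measurable_fun setT f.
Proof.
move=> mf _ B _; rewrite setTI.
rewrite (_ : f @^-1` B = \bigcup_(k in B) [set w | f w = k]).
  by apply: bigcup_measurable => k _.
by apply/seteqP; split=> [w Bw|w [k Bk /= ->]//]; exists (f w).
Qed.

Lemma measurable_nat_eq d (T : measurableType d) (f : T -> nat) k :
  measurable_fun setT f -> measurable [set w | f w = k].
Proof. by move=> mf; have := mf measurableT [set k] I; rewrite setTI. Qed.

Lemma measurable_fun_natr d (T : measurableType d) (R : realType) (f : T -> nat) :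
  measurable_fun setT f -> measurable_fun setT (fun w => (f w)%:R : R).
Proof. by move=> mf; apply: (measurableT_comp _ mf). Qed.

Lemma measurable_trajectory {R : realType} d (T : measurableType d)
    (M : {nonneg R} -> T -> nat) :
  (forall t, measurable_fun setT (M t)) -> measurable_fun setT (trajectory M).
Proof.
move=> mM; apply/measurable_pathsP => t; rewrite /trajectory /=.
exact: measurable_fun_natr.
Qed.

Section poisson_markov.
Context {R : realType} {d : measure_display} {T : measurableType d}.
Variables (P : probability T R) (lam : R) (N : {nonneg R} -> {RV P >-> nat}).
Hypothesis ppN : poisson_process lam N.

Let le1 (p q : {nonneg R} * nat) := p.1 <= q.1.

(* N, being at k at time a, passes through the points of l; the next value is
   written k + increment so that a decreasing list gives the empty event. *)
Fixpoint chain (a : {nonneg R}) (k : nat) (l : seq ({nonneg R} * nat)) (w : T) :=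
  if l is p :: l' then (k + (N p.1 w - N a w) == p.2)%N && chain p.1 p.2 l' w
  else true.

Fixpoint chain_prob (a : {nonneg R}) (k : nat) (l : seq ({nonneg R} * nat)) :
    \bar R :=
  if l is p :: l' then
    (P [set w | (k + (N p.1 w - N a w) = p.2)%N] * chain_prob p.1 p.2 l')%E
  else 1%E.

(** The reference time [b] stays fixed while the induction moves [a] along the list, the truncated
    differences adding up because N is nondecreasing. With b = 0 the chain prescribes values of N,
    with b = a values of N - N_a. *)
Lemma chainP a k l w : (forall b, b <= a -> (N a w - N b w)%N = k ->
  path le1 (a, k) l ->
  all (fun p => (N p.1 w - N b w == p.2)%N) l = chain a k l w).
Proof.
elim: l a k => //= p l IH a k b ba Nab /andP[ap pl].
have e : (N p.1 w - N b w = k + (N p.1 w - N a w))%N.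
  have := pp_nondecreasing ppN w ap; have := pp_nondecreasing ppN w ba.
  by rewrite -Nab /=; lia.
rewrite -e; case: eqP => //= e'; apply: IH => //.
  exact: le_trans ba ap.
by case: p pl {ap e e'}.
Qed.

Lemma chain_nth t0 a k l w : chain a k l w <->
  forall i, (i < size l)%N ->
    (nth 0%N (k :: unzip2 l) i +
     (N (nth t0 (a :: unzip1 l) i.+1) w - N (nth t0 (a :: unzip1 l) i) w) =
     nth 0%N (k :: unzip2 l) i.+1)%N.
Proof.
elim: l a k => //= p l IH a k; split.
  by move=> /andP[/eqP e /IH h] [|i] //=; rewrite ltnS; exact: h.
move=> h; apply/andP; split; first by apply/eqP; exact: (h 0%N).
by apply/IH => i il; exact: (h i.+1).
Qed.

Lemma chain_prob_prod t0 a k l : chain_prob a k l =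
  (\prod_(i < size l) P [set w |
    nth 0%N (k :: unzip2 l) i +
     (N (nth t0 (a :: unzip1 l) i.+1) w - N (nth t0 (a :: unzip1 l) i) w) =
     nth 0%N (k :: unzip2 l) i.+1]%N)%E.
Proof.
elim: l a k => [|p l IH] a k /=; first by rewrite big_ord0.
by rewrite big_ord_recl IH.
Qed.

Lemma chain_probE a k l : path le1 (a, k) l ->
  P [set w | chain a k l w] = chain_prob a k l.
Proof.
move=> pl; rewrite (chain_prob_prod a).
(* [pp_indep] takes times indexed by all integers and nondecreasing throughout, so the finite list
   is frozen at its last entry; that entry has index [size l], as [s] also contains [a]. *)
pose s := a :: unzip1 l; pose t i := nth a s (minn i (size l)).
have ss : sorted <=%R s.
  rewrite /s /unzip1 /=.
  by have := path_map (f := fst) (e' := <=%R : rel {nonneg R}) (a, k) l => /= ->.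
have tmono : {homo t : i j / (i <= j)%N >-> i <= j}.
  move=> i j ij; apply: (sorted_leq_nth le_trans le_refl) => //.
  - by rewrite inE /s /= size_map ltnS geq_minr.
  - by rewrite inE /s /= size_map ltnS geq_minr.
  - by rewrite leq_min geq_minr andbT (leq_trans (geq_minl _ _)).
have := pp_indep ppN tmono (n := size l) (B := fun i => [set m |
  nth 0%N (k :: unzip2 l) i + m = nth 0%N (k :: unzip2 l) i.+1]%N).
move=> /(_ (fun i => I)).
have tE (i : 'I_(size l)) : t i = nth a s i /\ t i.+1 = nth a s i.+1.
  by rewrite /t (minn_idPl _) ?(ltnW (ltn_ord i))// (minn_idPl _).
rewrite [X in P X = _](_ : _ = [set w | chain a k l w]).
  move=> ->; apply: eq_bigr => i _; have [-> ->] := tE i; exact: erefl.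
apply/seteqP; split=> w /=.
  move=> h; apply/(chain_nth a) => i il; have := h (Ordinal il) I.
  by rewrite /= (tE (Ordinal il)).1 (tE (Ordinal il)).2.
move=> /(chain_nth a) h i _ /=; rewrite (tE i).1 (tE i).2; exact: h.
Qed.

Lemma chain_prob_cat a k l p l' : chain_prob a k (l ++ p :: l') =
  (chain_prob a k (rcons l p) * chain_prob p.1 p.2 l')%E.
Proof.
elim: l a k => [|q l IH] a k /=; first by rewrite mule1.
by rewrite IH muleA.
Qed.

(** Only increments enter. This makes the probability of the part after [a] independent of the value
    j taken there, which turns a Markov factorisation into independence. *)
Lemma chain_prob_shift a j k l :
  chain_prob a (j + k) [seq (p.1, j + p.2)%N | p <- l] = chain_prob a k l.
Proof.
elim: l a k => //= p l IH a k; rewrite IH; congr (P _ * _)%E.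
by apply/seteqP; split=> w /=; rewrite -addnA; [move/addnI|move=> ->].
Qed.

(* Prescribing N a as well as the values before a turns the events after a,
   which bear on the increments from a, into prescriptions of values of N. *)
Let before (a : {nonneg R}) (l : seq ({nonneg R} * nat)) (j : nat) : set T :=
  [set w | all (fun p => N p.1 w == p.2) l /\ N a w = j].

Let beyond (a : {nonneg R}) (l : seq ({nonneg R} * nat)) : set T :=
  [set w | all (fun p => (N p.1 w - N a w == p.2)%N) l].

(** Both events and their intersection are chains; the chain of the intersection passes through (a,
    j), where its probability factors, and the second factor is then shifted back from j to 0. *)
Lemma before_beyond_indep a l j l' : all (fun p => p.1 <= a) l ->
  all (fun p => a <= p.1) l' ->
  P (before a l j `&` beyond a l') = (P (before a l j) * P (beyond a l'))%E.
Proof.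
have le1_total : total le1 by move=> p q; exact: le_total.
have le1_trans : transitive le1 by move=> p q r; exact: le_trans.
(* The order of a list does not affect the event it describes, but a chain must visit its times in
   increasing order. *)
wlog [sl sl'] : l l' / sorted le1 l /\ sorted le1 l'.
  move=> wlg la al'.
  have pl := permEl (perm_sort le1 l); have pl' := permEl (perm_sort le1 l').
  have -> : before a l j = before a (sort le1 l) j.
    by apply/seteqP; split=> w; rewrite /before /= (perm_all _ pl).
  have -> : beyond a l' = beyond a (sort le1 l').
    by apply/seteqP; split=> w; rewrite /beyond /= (perm_all _ pl').
  apply: wlg; rewrite ?(perm_all _ pl) ?(perm_all _ pl')//.
  by split; apply: sort_sorted.
move=> la al'.
have N0 w (t : {nonneg R}) : (N t w - N (0%R)%:nng w)%N = N t w.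
  by rewrite (pp_start ppN) subn0.
have p0 : path le1 (0%:nng, 0%N) (rcons l (a, j)).
  rewrite rcons_path path_min_sorted ?sl /=; last first.
    by apply/allP => p _; rewrite /le1 -num_le /=.
  have [->|l0] := eqVneq l [::]; first by rewrite /le1 /= -num_le /=.
  have : last (0%:nng, 0%N) l \in l.
    by case: l l0 {sl la} => //= p l _; rewrite mem_last.
  by move=> /(allP la).
have pa k : path le1 (a, k) l' by rewrite path_min_sorted.
have pas : path le1 (a, j) [seq (p.1, j + p.2)%N | p <- l'].
  by rewrite path_min_sorted ?sorted_map ?all_map.
have beforeE : before a l j = [set w | chain 0%:nng 0 (rcons l (a, j)) w].
  apply/seteqP; split=> w; rewrite /= -(@chainP _ _ _ _ 0%:nng)// ?subnn//;
    rewrite all_rcons /= N0.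
    move=> [h ->]; rewrite eqxx /=; apply/allP => p /(allP h).
    by rewrite N0.
  move=> /andP[/eqP Na h]; split=> //; apply/allP => p /(allP h).
  by rewrite N0.
have beyondE : beyond a l' = [set w | chain a 0 l' w].
  by apply/seteqP; split=> w; rewrite /beyond /= (@chainP a 0%N l' w a)// subnn.
have bothE : before a l j `&` beyond a l' =
    [set w | chain 0%:nng 0 (l ++ (a, j) :: [seq (p.1, j + p.2)%N | p <- l']) w].
  apply/seteqP; split=> w /=.
    move=> [[h Na] h']; rewrite -(@chainP _ _ _ _ 0%:nng)// ?subnn//; last first.
      by rewrite -cat_rcons cat_path p0 last_rcons.
    rewrite all_cat /= N0 Na eqxx /=; apply/andP; split.
      by apply/allP => p /(allP h); rewrite N0.
    rewrite all_map; apply/allP => p pl' /=; rewrite N0.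
    have := allP h' _ pl' => /eqP <-.
    by rewrite -Na subnKC// (pp_nondecreasing ppN)// (allP al').
  rewrite -(@chainP _ _ _ _ 0%:nng)// ?subnn//; last first.
    by rewrite -cat_rcons cat_path p0 last_rcons.
  rewrite all_cat /= N0 => /and3P[h /eqP Na h']; split.
    by split=> //; apply/allP => p /(allP h); rewrite N0.
  apply/allP => p pl'; move: h'; rewrite all_map => /allP/(_ _ pl')/=.
  by rewrite N0 => /eqP ->; rewrite Na addKn.
rewrite bothE beforeE beyondE !chain_probE// ?chain_prob_cat//=; last first.
  by rewrite -cat_rcons cat_path p0 last_rcons.
by rewrite -[X in chain_prob a X]addn0 chain_prob_shift.
Qed.

Let measurable_all (f : {nonneg R} * nat -> T -> nat) (l : seq ({nonneg R} * nat)) :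
  (forall p, measurable_fun setT (f p)) ->
  measurable [set w | all (fun p => f p w == p.2) l].
Proof.
move=> mf; elim: l => [|p l IH] /=.
  by rewrite (_ : [set w | true] = setT)// -subTset.
rewrite (_ : [set w | _] =
    (f p @^-1` [set p.2]) `&` [set w | all (fun p => f p w == p.2) l]).
  by apply: measurableI => //; exact: measurable_nat_eq.
by apply/seteqP; split=> w /=; [move=> /andP[/eqP ? ?]|move=> [-> ->]; rewrite eqxx].
Qed.

Lemma measurable_poisson t : measurable_fun setT (N t : T -> nat).
Proof. by []. Qed.

Lemma measurable_poissonB t s : measurable_fun setT (fun w => N t w - N s w)%N.
Proof. exact: measurable_fun_subn. Qed.

Lemma measurable_after a : measurable_fun setT (after N a).
Proof. by apply: measurable_trajectory => t; exact: measurable_poissonB. Qed.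

Lemma measurable_stopped a : measurable_fun setT (stopped N a).
Proof. by apply: measurable_trajectory => t; exact: measurable_poisson. Qed.

Lemma after_stopped_indep a : indep P (after N a) (stopped N a).
Proof.
(* The empty set is adjoined because events prescribing different values of N_a are disjoint, and
   [G] must be closed under intersection. *)
pose G := [set A | A = set0 \/ exists l j, all (fun p => p.1 <= a) l /\ A = before a l j].
pose H := [set A | exists2 l, all (fun p => a <= p.1) l & A = beyond a l].
have GI : setI_closed G.
  move=> A B [->|[l [j [la ->]]]]; first by left; rewrite set0I.
  move=> [->|[l' [j' [la' ->]]]]; first by left; rewrite setI0.
  have [jj'|jj'] := eqVneq j j'; last first.
    left; rewrite -subset0 => w [[_ wj] [_ wj']].
    by move: jj'; rewrite -wj -wj' eqxx.
  right; exists (l ++ l'), j; rewrite all_cat la la'; split=> //.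
  apply/seteqP; split=> w; rewrite /before /= all_cat -jj'.
    by move=> [[-> ->] [-> _]].
  by move=> [/andP[-> ->] ->].
have HI : setI_closed H.
  move=> _ _ [l la ->] [l' la' ->]; exists (l ++ l'); first by rewrite all_cat la.
  by apply/seteqP; split=> w; rewrite /beyond /= all_cat => /andP.
have mG : G `<=` measurable.
  move=> _ [->//|[l [j [_ ->]]]]; apply: measurableI.
    exact: (measurable_all l (fun p => measurable_poisson p.1)).
  exact: (measurable_nat_eq j (measurable_poisson a)).
have mH : H `<=` measurable.
  by move=> _ [l _ ->]; exact: (measurable_all l (fun p => measurable_poissonB p.1 a)).
have GH A B : G A -> H B -> P (A `&` B) = (P A * P B)%E.
  move=> [->|[l [j [la ->]]]] [l' la' ->]; first by rewrite set0I measure0 mul0e.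
  exact: before_beyond_indep.
have sH : measurable_fun [set: g_sigma_algebraType H] (after N a).
  apply: measurable_trajectory => t; apply: measurable_fun_nat => k.
  apply: sub_sigma_algebra; exists [:: (Num.max t a, k)].
    by rewrite /= le_max lexx orbT.
  by apply/seteqP; split=> w; rewrite /beyond /= andbT => /eqP.
have sG : measurable_fun [set: g_sigma_algebraType G] (stopped N a).
  apply: measurable_trajectory => t; apply: measurable_fun_nat => k.
  (* Events of [G] also prescribe N_a, so a condition on a single earlier value is recovered as a
     countable union over the values j of N_a. *)
  rewrite (_ : [set _ | _] = \bigcup_j before a [:: (Num.min t a, k)] j).
    apply: bigcup_measurable => j _; apply: sub_sigma_algebra; right.
    by exists [:: (Num.min t a, k)], j; rewrite /= ge_min lexx orbT.
  apply/seteqP; split=> w; rewrite /before /=.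
    by move=> <-; exists (N a w) => //=; rewrite eqxx.
  by move=> [j _] /= [/andP[/eqP]].
move=> A B mA mB; rewrite setIC muleC.
apply: (pi_system_indep GI HI mG mH GH).
- by have := sG measurableT B mB; rewrite setTI.
- by have := sH measurableT A mA; rewrite setTI.
Qed.

End poisson_markov.

(** * Laplace functional of the Poisson process *)

Section poisson_laplace.
Context {R : realType} {d : measure_display} {T : measurableType d}.
Variable P : probability T R.

Lemma nneseries_expR (x : R) : 0 <= x ->
  (\sum_(k <oo) (x ^+ k / k`!%:R)%:E = (expR x)%:E)%E.
Proof.
move=> x0; rewrite /expR -EFin_lim; last exact: is_cvg_series_exp_coeff.
by apply/congr_lim/funext => n /=; rewrite /series /= -sumEFin.
Qed.

Lemma poisson_laplace (r b : R) (f : T -> nat) : 0 < r ->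
  measurable_fun setT f ->
  (forall k, P [set w | f w = k] = (poisson_pmf r k)%:E) ->
  (\int[P]_w (expR (- (b * (f w)%:R)))%:E =
   (expR (- (r * (1 - expR (- b)))))%:E)%E.
Proof.
move=> r0 mf fP.
have UF : [set: T] = \bigcup_k [set w | f w = k].
  by apply/seteqP; split=> // w _; exists (f w).
rewrite UF ge0_integral_bigcup; last 4 first.
- by move=> k; exact: measurable_nat_eq.
- rewrite -UF; apply/measurable_EFinP; apply: measurableT_comp => //.
  apply: measurableT_comp => //; apply: measurable_funM => //.
  exact: measurable_fun_natr.
- by move=> w _; rewrite lee_fin expR_ge0.
- by move=> i j _ _ [w [/= <- <-]].
have e k : (\int[P]_(w in [set w | f w = k]) (expR (- (b * (f w)%:R)))%:E =
    (expR (- r))%:E * ((r * expR (- b)) ^+ k / k`!%:R)%:E)%E.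
  rewrite (eq_integral (cst (expR (- (b * k%:R)))%:E)); last first.
    by move=> w /[!inE] /= ->.
  rewrite integral_cst//; last exact: measurable_nat_eq.
  transitivity ((expR (- (b * k%:R)))%:E * (poisson_pmf r k)%:E)%E.
    by congr (_ * _)%E; exact: fP.
  rewrite -EFinM /poisson_pmf r0; congr EFin.
  have -> : expR (- (b * k%:R)) = expR (- b) ^+ k.
    by rewrite -expRM_natl mulrN mulrC.
  by rewrite exprMn; ring.
under eq_eseriesr do rewrite e.
rewrite nneseriesZl; last first.
  by move=> k _; rewrite lee_fin divr_ge0// exprn_ge0// mulr_ge0 ?expR_ge0// ltW.
rewrite nneseries_expR; last by rewrite mulr_ge0 ?expR_ge0// ltW.
by rewrite -EFinM -expRD; congr (expR _)%:E; ring.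
Qed.

End poisson_laplace.

Lemma pairing_stopped {R : realType} d (T : measurableType d)
    (M : {nonneg R} -> T -> nat)
    (u : {nonneg R}) (c : seq ({nonneg R} * R)) w :
  all (fun p : {nonneg R} * R => p.1 <= u) c ->
  pairing c (stopped M u w) = pairing c (trajectory M w).
Proof.
elim: c => [|p c IH]; first by rewrite /pairing !big_nil.
move=> /= /andP[pu /IH cu]; rewrite !pairing_cons cu.
by rewrite /stopped /trajectory /= (min_idPl pu).
Qed.

Section poisson_process_laplace.
Context {R : realType} {d : measure_display} {T : measurableType d}.
Variables (P : probability T R) (lam : R) (N : {nonneg R} -> {RV P >-> nat}).
Hypotheses (lam_gt0 : 0 < lam) (ppN : poisson_process lam N).
Implicit Type c : seq ({nonneg R} * R).

Definition step_exponent (D : set (measurableTypeR R)) c : \bar R :=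
  (\int[lebesgue_measure]_(s in D) (1 - expR (- pairing c (step s)))%:E)%E.

Lemma measurable_step_exponent c : measurable_fun setT
  (fun s : measurableTypeR R => (1 - expR (- pairing c (step s)))%:E).
Proof.
apply/measurable_EFinP/measurable_funB => //.
exact: (measurableT_comp (measurable_expR_pairing c) measurable_step).
Qed.

Lemma step_exponent_integrand_ge0 c s : nneg_coef c ->
  (0 <= (1 - expR (- pairing c (step s)))%:E)%E.
Proof.
move=> c0; rewrite lee_fin.
by have /andP[] := expR_sub01 (pairing_ge0 (step s) c0).
Qed.

Lemma step_exponent_ge0 D c : nneg_coef c -> (0 <= step_exponent D c)%E.
Proof. by move=> c0; apply: integral_ge0 => s _; exact: step_exponent_integrand_ge0. Qed.

Lemma pairing_step0 c (u : {nonneg R}) (s : R) :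
  all (fun p => p.1 <= u) c -> u%:num < s -> pairing c (step s) = 0.
Proof.
move=> + us; elim: c => [|p c IH] /=; first by rewrite /pairing big_nil.
move=> /andP[pu /IH e]; rewrite pairing_cons e addr0 /step /=.
have pu' : p.1%:num <= u%:num by [].
by rewrite leNgt (le_lt_trans pu' us)/= mulr0.
Qed.

(** Moving the mass b from t back to u only affects steps at s in ]u,t]. Such a step is seen by the
    mass at t alone, all other times being at most u, whence the constant 1 - e^(-b) times the
    length. This matches the exponent of the increment from u to t. *)
Lemma step_exponent_cons (t u : {nonneg R}) (b : R) c : u <= t -> 0 <= b ->
  nneg_coef c -> all (fun p => p.1 <= u) c ->
  (step_exponent `]0%R, +oo[ ((t, b) :: c) =
   ((1 - expR (- b)) * (t%:num - u%:num))%:E +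
   step_exponent `]0%R, +oo[ ((u, b) :: c))%E.
Proof.
move=> ut b0 c0 cu; have ut' : u%:num <= t%:num by [].
have /andP[B0 _] := expR_sub01 b0.
rewrite /step_exponent.
have -> : ((1 - expR (- b)) * (t%:num - u%:num))%:E =
  (\int[lebesgue_measure]_(s in `]0%R, +oo[)
     ((1 - expR (- b))%:E * (\1_(`]u%:num, t%:num]) s)%:E))%E :> \bar R.
  rewrite ge0_integralZl//=; last first.
    by apply: measurable_funTS; apply: measurableT_comp.
  rewrite integral_indic//= setIidl; last first.
    move=> s /=; rewrite !in_itv/= andbT => /andP[us _].
    exact: le_lt_trans us.
  rewrite lebesgue_measure_itv /= lte_fin EFinM; congr (_ * _)%E.
  case: ltP => // tu; rewrite (_ : t%:num = u%:num) ?subrr//.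
  by apply/eqP; rewrite eq_le tu.
rewrite -ge0_integralD//; last 4 first.
- by move=> s _; rewrite -EFinM lee_fin mulr_ge0.
- apply/measurable_EFinP/measurable_funTS/measurable_funM => //.
- by move=> s _; apply: step_exponent_integrand_ge0; rewrite /= b0.
- by apply: measurable_funTS; exact: measurable_step_exponent.
apply: eq_integral => s _; rewrite -EFinM -EFinD; congr EFin.
rewrite !pairing_cons /= indicE mem_setE in_itv/=.
have [us|su] := ltP u%:num s.
  rewrite (pairing_step0 cu us) !addr0 /= mulr0 oppr0 expR0 subrr addr0.
  by case: (s <= t%:num); rewrite ?mulr1 ?mulr0 ?oppr0 ?expR0 ?subrr.
by rewrite (le_trans su ut') /= mulr0 add0r.
Qed.

Lemma measurable_poisson_trajectory :
  measurable_fun setT (trajectory (fun t => N t : T -> nat)).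
Proof. by apply: measurable_trajectory => t. Qed.

Lemma poisson_increment_laplace (t u : {nonneg R}) b : u <= t ->
  (\int[P]_w (expR (- (b * (N t w - N u w)%N%:R)))%:E =
   (expR (- (lam * ((1 - expR (- b)) * (t%:num - u%:num)))))%:E)%E.
Proof.
rewrite le_eqVlt => /predU1P[->|ut].
  rewrite subrr !mulr0 oppr0 expR0.
  under eq_integral do rewrite subnn mulr0 oppr0 expR0.
  by rewrite integral_cst// mul1e; exact: probability_setT.
have ut' : u%:num < t%:num by [].
rewrite (@poisson_laplace _ _ _ _ (lam * (t%:num - u%:num))).
- by congr (expR (- _))%:E; ring.
- by rewrite mulr_gt0// subr_gt0.
- exact: measurable_fun_subn.
- move=> k; rewrite (pp_increment ppN ut) lebesgue_measure_itv /= lte_fin ut'.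
  by rewrite -EFinB.
Qed.

Let claim c :=
  (\int[P]_w (expR (- pairing c (trajectory (fun t => N t : T -> nat) w)))%:E =
  expeR (- (lam%:E * step_exponent `]0%R, +oo[ c)))%E.

(** Write b N_t as b (N_t - N_u) + b N_u: the first term is a functional of the path counted from u,
    the rest of the path stopped at u, and these are independent. *)
Let claim_cons (t u : {nonneg R}) (b : R) c : u <= t -> 0 <= b ->
  nneg_coef c -> all (fun p => p.1 <= u) c ->
  claim ((u, b) :: c) -> claim ((t, b) :: c).
Proof.
move=> ut b0 c0 cu; rewrite /claim (step_exponent_cons ut)// => IH.
have nn : nneg_coef ((u, b) :: c) by rewrite /= b0.
have B0 : 0 <= (1 - expR (- b)) * (t%:num - u%:num).
  by have /andP[? _] := expR_sub01 b0; rewrite mulr_ge0// subr_ge0.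
rewrite ge0_muleDr ?step_exponent_ge0//.
rewrite -EFinM addeC fin_num_oppeD// expeRD -IH muleC /= -(poisson_increment_laplace b ut).
pose f (y : paths {nonneg R} R) := expR (- (b * (y t)%:num)).
pose g (y : paths {nonneg R} R) := expR (- pairing ((u, b) :: c) y).
have fE w : f (after (fun t => N t : T -> nat) u w) =
    expR (- (b * (N t w - N u w)%N%:R)).
  by rewrite /f /after /trajectory /= (max_idPl ut).
have gE w : g (stopped (fun t => N t : T -> nat) u w) =
    expR (- pairing ((u, b) :: c) (trajectory (fun t => N t : T -> nat) w)).
  by rewrite /g pairing_stopped//= lexx.
under [X in (_ = X * _)%E]eq_integral do rewrite -fE.
under [X in (_ = _ * X)%E]eq_integral do rewrite -gE.
rewrite -(indep_integralM (measurable_after N u) (measurable_stopped N u)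
  (after_stopped_indep ppN u)).
- apply: eq_integral => w _; rewrite fE gE -expRD; congr (expR _)%:E.
  rewrite !pairing_cons /trajectory /= natrB ?(pp_nondecreasing ppN)//.
  by ring.
- apply: measurableT_comp => //; apply: measurableT_comp => //.
  by apply: measurable_funM => //; exact: measurable_eval.
- by move=> y; exact: expR_ge0.
- exact: measurable_expR_pairing.
- by move=> y; exact: expR_ge0.
Qed.

Let claim_eq c c' : (forall y, pairing c y = pairing c' y) -> claim c' -> claim c.
Proof.
move=> cc'; rewrite /claim /step_exponent.
under eq_integral do rewrite -cc'.
by under [in X in _ = X -> _]eq_integral do rewrite -cc'.
Qed.

Let claim0 c : all (fun p : {nonneg R} * R => p.1 <= 0%:nng) c -> claim c.
Proof.
move=> c0; rewrite /claim.
have N0 w : pairing c (trajectory (fun t => N t : T -> nat) w) = 0.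
  elim: c c0 => [|p c IH]; first by rewrite /pairing big_nil.
  move=> /= /andP[p0 /IH e]; rewrite pairing_cons e addr0 /trajectory /=.
  have /eqP -> : N p.1 w == 0%N.
    by rewrite -leqn0 -(pp_start ppN w) (pp_nondecreasing ppN).
  by rewrite mulr0.
under eq_integral do rewrite N0 oppr0 expR0.
rewrite integral_cst// mul1e [LHS](_ : _ = 1%E); last exact: probability_setT.
rewrite /step_exponent integral0_eq ?mule0 ?oppe0 ?expeR0//.
move=> s /=; rewrite in_itv/= andbT => s0.
by rewrite (pairing_step0 c0) ?oppr0 ?expR0 ?subrr.
Qed.

Theorem poisson_process_laplace c : nneg_coef c ->
  (\int[P]_w (expR (- pairing c (trajectory (fun t => N t : T -> nat) w)))%:E =
   expeR (- (lam%:E * step_exponent `]0%R, +oo[ c)))%E.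
Proof.
pose ge1 (p q : {nonneg R} * R) := q.1 <= p.1.
wlog : c / sorted ge1 c.
  move=> wlg c0; have pc := permEl (perm_sort ge1 c).
  apply: (@claim_eq c (sort ge1 c)).
    by move=> y; apply: perm_big; rewrite perm_sym.
  apply: wlg; last by rewrite /nneg_coef (perm_all _ pc).
  by apply: sort_sorted => p q; exact: le_total.
(* Induction on the length, since the list to which the hypothesis is applied has a modified head
   and is not a sublist of [c]. *)
elim: {c}(size c) {-2}c (leqnn (size c)) => [|n IH] [|[t b] c]//=.
- by move=> _ _ _; exact: (@claim0 [::] isT).
- by move=> _ _ _; exact: (@claim0 [::] isT).
rewrite ltnS => cn tc /andP[b0 c0].
case: c cn tc c0 => [|[u b'] c] /= cn.
  (* The last remaining time is moved back to 0, where N vanishes. *)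
  move=> _ _; apply: (@claim_cons t 0%:nng b [::]) => //.
    by rewrite -num_le /=.
  by apply: claim0; rewrite /= lexx.
move=> /andP[ut uc] /andP[b'0 c0].
have ge1_trans : transitive ge1 by move=> p q r /[swap]; exact: le_trans.
have cu : all (fun p => p.1 <= u) c by have := order_path_min ge1_trans uc.
(* Once the latest time t is moved back to the next one, u, the two masses at u merge into b + b'
   and the list is shorter by one. *)
apply: (@claim_cons t u b ((u, b') :: c)) => //=; rewrite ?b'0 ?lexx//.
apply: (@claim_eq _ ((u, b + b') :: c)).
  by move=> y; rewrite !pairing_cons addrA mulrDl.
apply: IH => //=; last by rewrite addr_ge0.
by rewrite path_min_sorted ?(path_sorted uc).
Qed.

End poisson_process_laplace.

(** * Equality in law and cancellation of Laplace factors *)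

Lemma mulIe {R : realType} (x a b : \bar R) : x \is a fin_num -> x != 0%E ->
  (a * x = b * x -> a = b)%E.
Proof.
move=> xfin x0 ab.
by rewrite -(mule1 a) -(mule1 b) -(divee xfin x0) !muleA ab.
Qed.

Section laplace_law.
Context {R : realType} {E : Type}.
Context {d d' : measure_display} {T : measurableType d} {T' : measurableType d'}.
Variables (P : probability T R) (P' : probability T' R).
Variables (psi : T -> paths E R) (psi' : T' -> paths E R).
Hypotheses (mpsi : measurable_fun setT psi) (mpsi' : measurable_fun setT psi').

Lemma laplace_eq_law :
  (forall c : seq (E * R), nneg_coef c ->
    \int[P]_w (expR (- pairing c (psi w)))%:E =
    \int[P']_w (expR (- pairing c (psi' w)))%:E)%E ->
  eq_law P psi P' psi'.
Proof.
move=> eqL n t B mB.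
pose A := fdd id t @^-1` B : set (paths E R).
have mA : measurable A := measurable_cylinder t mB.
have int1 d0 (T0 : measurableType d0) (Q : probability T0 R) (X : T0 -> paths E R) :
    measurable_fun setT X ->
    (\int[Q]_(w in X @^-1` A) (cst 1 w)%:E = Q (X @^-1` A))%E.
  move=> mX; have mXA : measurable (X @^-1` A).
    by rewrite -[X in measurable X]setTI; exact: mX.
  by have := integral_cst Q mXA 1%E; rewrite mul1e.
have iZ d0 (T0 : measurableType d0) (Q : probability T0 R) :
    Q.-integrable setT (EFin \o cst 1).
  exact: finite_measure_integrable_cst.
rewrite -[LHS](int1 _ _ _ _ mpsi) -[RHS](int1 _ _ _ _ mpsi').
apply: (laplace_unique mpsi mpsi') => //; [exact: iZ|exact: iZ|move=> c c0].
under eq_integral do rewrite mul1r.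
under [RHS]eq_integral do rewrite mul1r.
exact: eqL.
Qed.

(** The exponential reads a path only at the finitely many times of [c], so it is a measurable
    function of one finite-dimensional marginal. *)
Lemma eq_law_laplace (c : seq (E * R)) : eq_law P psi P' psi' ->
  (\int[P]_w (expR (- pairing c (psi w)))%:E =
   \int[P']_w (expR (- pairing c (psi' w)))%:E)%E.
Proof.
move=> eql; pose t i := (tnth (in_tuple c) i).1.
pose G (v : (size c).-tuple R) : R :=
  expR (- \sum_(i < size c) (tnth (in_tuple c) i).2 * tnth v i).
have mG : measurable_fun setT (EFin \o G).
  apply/measurable_EFinP; apply: measurableT_comp => //; apply: measurableT_comp => //.
  by apply: measurable_sum => i; apply: measurable_funM => //; exact: measurable_tnth.
have GE d0 (T0 : measurableType d0) (X : T0 -> paths E R) w :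
    expR (- pairing c (X w)) = G (fdd X t w).
  by rewrite pairing_tnth /G; congr (expR (- _)); apply: eq_bigr => i _;
    rewrite tnth_mktuple.
pose X : {RV P >-> (size c).-tuple R} :=
  HB.pack (fdd psi t) (isMeasurableFun.Build _ _ _ _ _ (measurable_fdd t mpsi)).
pose X' : {RV P' >-> (size c).-tuple R} :=
  HB.pack (fdd psi' t) (isMeasurableFun.Build _ _ _ _ _ (measurable_fdd t mpsi')).
transitivity (\int[distribution P X]_v (EFin \o G) v)%E.
  rewrite ge0_integral_distribution//; last by move=> v; rewrite lee_fin expR_ge0.
  by apply: eq_integral => w _; rewrite GE.
transitivity (\int[distribution P' X']_v (EFin \o G) v)%E; last first.
  rewrite ge0_integral_distribution//; last by move=> v; rewrite lee_fin expR_ge0.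
  by apply: eq_integral => w _; rewrite GE.
by apply: eq_measure_integral => B mB _; exact: eql.
Qed.

Lemma laplace_fin_num (c : seq (E * R)) : nneg_coef c ->
  (\int[P]_w (expR (- pairing c (psi w)))%:E)%E \is a fin_num.
Proof.
move=> c0; apply: integrable_fin_num => //.
apply: (eq_integrable measurableT
  (fun w => (cst 1 w * expR (- pairing c (psi w)))%:E)).
  by move=> w _; rewrite /= mul1r.
apply: integrable_mul01.
- exact: finite_measure_integrable_cst.
- exact: (measurableT_comp (measurable_expR_pairing c)).
- by move=> w; exact: expR_pairing01.
Qed.

Lemma laplace_neq0 (c : seq (E * R)) : nneg_coef c ->
  (\int[P]_w (expR (- pairing c (psi w)))%:E != 0)%E.
Proof. by move=> c0; have := laplace_gt0 P mpsi c0; rewrite unlock => /gt_eqF ->. Qed.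

End laplace_law.

(** * The process before and after a, and conditioning on N_a = 0 *)

Section poisson_decomposition.
Context {R : realType} {d : measure_display} {T : measurableType d}.
Variables (P : probability T R) (lam : R) (N : {nonneg R} -> {RV P >-> nat}).
Hypotheses (lam_gt0 : 0 < lam) (ppN : poisson_process lam N).
Implicit Type c : seq ({nonneg R} * R).
Let Nt := (fun t => N t : T -> nat).

Lemma after_stoppedE a w :
  trajectory Nt w = padd (after Nt a w) (stopped Nt a w).
Proof.
apply/funext => t; apply/val_inj => /=.
rewrite -natrD /Nt; congr _%:R; have [ta|/ltW at_] := leP t a.
  by rewrite subnn.
by rewrite subnK// (pp_nondecreasing ppN).
Qed.

(** Stopping at a replaces each time t by min(t,a). A step at s > a is then never seen, while for s
    <= a the conditions s <= min(t,a) and s <= t agree. The endpoint 0 is Lebesgue-null. *)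
Lemma step_exponent_min (a : {nonneg R}) c : nneg_coef c ->
  step_exponent `]0%R, +oo[ [seq (Num.min p.1 a, p.2) | p <- c] =
  step_exponent `[0%R, a%:num] c.
Proof.
move=> c0; rewrite /step_exponent; set c' := map _ c.
have c'0 : nneg_coef c' by rewrite /nneg_coef all_map.
have c'a : all (fun p : {nonneg R} * R => p.1 <= a) c'.
  by rewrite all_map; apply/allP => p _ /=; rewrite ge_min lexx orbT.
have U : `]0%R, +oo[%classic = `]0%R, a%:num]%classic `|` `]a%:num, +oo[%classic.
  rewrite -itv_bndbnd_setU//; first by rewrite bnd_simp.
rewrite U ge0_integral_setU//=; last 3 first.
- by apply: measurable_funTS; exact: measurable_step_exponent.
- by move=> s _; exact: step_exponent_integrand_ge0.
- apply/disj_setPS => s [] /=; rewrite !in_itv/= andbT => /andP[_ sa] /lt_geF.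
  by rewrite sa.
rewrite [X in (_ + X)%E](integral0_eq _) ?adde0; last first.
  move=> s /=; rewrite in_itv/= andbT => as_.
  by rewrite (pairing_step0 c'a as_) oppr0 expR0 subrr.
rewrite -integral_itv_obnd_cbnd; last first.
  by apply: measurable_funTS; exact: measurable_step_exponent.
apply: eq_integral => s; rewrite inE/= in_itv/= => /andP[_ sa].
congr (1 - expR (- _))%:E; rewrite /c' {c0 c'0 c'a c'}.
elim: c => [|p c IH]; first by rewrite /pairing !big_nil.
rewrite /= !pairing_cons IH; congr (_ * _ + _).
by rewrite /step /= num_min le_min sa andbT.
Qed.

Lemma stopped_laplace (a : {nonneg R}) c : nneg_coef c ->
  (\int[P]_w (expR (- pairing c (stopped Nt a w)))%:E =
   expeR (- (lam%:E * step_exponent `[0%R, a%:num] c)))%E.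
Proof.
move=> c0; rewrite -step_exponent_min// -(poisson_process_laplace lam_gt0 ppN); last first.
  by rewrite /nneg_coef all_map.
apply: eq_integral => w _; congr (expR (- _))%:E.
by rewrite /pairing big_map.
Qed.

Lemma step_exponent_split (a : {nonneg R}) c : nneg_coef c ->
  (step_exponent `]0%R, +oo[ c =
   step_exponent `[a%:num, +oo[ c + step_exponent `[0%R, a%:num] c)%E.
Proof.
move=> c0; have mf (D : set (measurableTypeR R)) : measurable_fun D
    (fun s : measurableTypeR R => (1 - expR (- pairing c (step s)))%:E).
  by apply: measurable_funTS; exact: measurable_step_exponent.
rewrite /step_exponent addeC -integral_itv_obnd_cbnd//.
rewrite -[X in (_ + X)%E]integral_itv_obnd_cbnd//.
have -> : `]0%R, +oo[%classic = `]0%R, a%:num]%classic `|` `]a%:num, +oo[%classic.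
  by rewrite -itv_bndbnd_setU// bnd_simp.
rewrite ge0_integral_setU//=.
- by move=> s _; exact: step_exponent_integrand_ge0.
- apply/disj_setPS => s [] /=; rewrite !in_itv/= andbT => /andP[_ sa] /lt_geF.
  by rewrite sa.
- exact: mf.
- exact: mf.
Qed.

Lemma laplace_after_stopped (a : {nonneg R}) c :
  (\int[P]_w (expR (- pairing c (trajectory Nt w)))%:E =
   \int[P]_w (expR (- pairing c (after Nt a w)))%:E *
   \int[P]_w (expR (- pairing c (stopped Nt a w)))%:E)%E.
Proof.
rewrite -(indep_integralM (f := fun y => expR (- pairing c y))
  (g := fun y => expR (- pairing c y)) (measurable_after N a)
  (measurable_stopped N a) (after_stopped_indep ppN a)).
- apply: eq_integral => w _.
  by rewrite (after_stoppedE a) pairing_padd opprD expRD.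
- exact: measurable_expR_pairing.
- by move=> y; exact: expR_ge0.
- exact: measurable_expR_pairing.
- by move=> y; exact: expR_ge0.
Qed.

(** Obtained by division: N is the independent sum of the two parts, the exponent of N splits at a,
    and the factor of the stopped part is already known. *)
Lemma after_laplace (a : {nonneg R}) c : nneg_coef c ->
  (\int[P]_w (expR (- pairing c (after Nt a w)))%:E =
   expeR (- (lam%:E * step_exponent `[a%:num, +oo[ c)))%E.
Proof.
move=> c0; apply: (@mulIe _ (\int[P]_w (expR (- pairing c (stopped Nt a w)))%:E)%E).
- exact: (laplace_fin_num P (measurable_stopped N a) c0).
- exact: (laplace_neq0 P (measurable_stopped N a) c0).
rewrite -laplace_after_stopped (poisson_process_laplace lam_gt0 ppN)//.
rewrite stopped_laplace// -expeRD (step_exponent_split a)//.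
rewrite ge0_muleDr ?step_exponent_ge0// oppeD//.
by rewrite ge0_adde_def// inE mule_ge0// ?step_exponent_ge0// lee_fin ltW.
Qed.

Lemma poisson_zero_prob (a : {nonneg R}) : 0 < a%:num ->
  exists2 p : R, 0 < p & P [set w | N a w = 0%N] = p%:E.
Proof.
move=> a0; have a0' : 0%:nng < a by [].
have -> : [set w | N a w = 0%N] = [set w | (N a w - N (0%R)%:nng w)%N = 0%N].
  by apply/seteqP; split=> w /=; rewrite (pp_start ppN) subn0.
rewrite (pp_increment ppN a0'); eexists; last by [].
rewrite /poisson_pmf; case: ifP => // r0.
by rewrite expr0 mul1r fact0 invr1 mul1r expR_gt0.
Qed.

(** On the event N_a = 0, monotonicity makes N vanish up to a, so N coincides there with the path
    counted from a. The event belongs to the stopped path, hence is independent of the latter, and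
    its positive probability cancels. *)
Lemma conditional_eq_law_after (a : {nonneg R}) : 0 < a%:num ->
  eq_law (conditional P [set w | N a w = 0%N]) (trajectory Nt) P (after Nt a).
Proof.
move=> a0 n t B mB; have [p p0 Pp] := poisson_zero_prob a0.
pose A := fdd id t @^-1` B : set (paths {nonneg R} R).
have mA : measurable A := measurable_cylinder t mB.
pose Z := ~` [set y : paths {nonneg R} R | 0 < (y a)%:num].
have mZ : measurable Z by apply: measurableC; exact: measurable_eval_gt.
have ZE : [set w | N a w = 0%N] = stopped Nt a @^-1` Z.
  apply/seteqP; split=> w; rewrite /Z /stopped /trajectory /Nt /= minxx.
    by move=> ->; rewrite ltxx.
  by move/negP; rewrite ltr0n -eqn0Ngt => /eqP.
have -> : fdd (after Nt a) t @^-1` B = after Nt a @^-1` A by [].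
rewrite /conditional.
have -> : fdd (trajectory Nt) t @^-1` B `&` [set w | N a w = 0%N] =
    after Nt a @^-1` A `&` stopped Nt a @^-1` Z.
  rewrite -ZE; apply/seteqP; split=> w [Bw Nw]; split=> //; move: Bw;
  rewrite /A /=; congr (B _); apply/eq_from_tnth => i; rewrite !tnth_mktuple /=;
  congr _%:R; rewrite /Nt Nw subn0; have [ta|//] := leP (t i) a;
  rewrite Nw; have := pp_nondecreasing ppN w ta; rewrite Nw leqn0 => /eqP -> //.
rewrite (after_stopped_indep ppN a mA mZ) -ZE Pp -muleA divee ?mule1//.
by rewrite eqe gt_eqF.
Qed.

Lemma poisson_decomposition_laplace (a : {nonneg R}) d' (T' : measurableType d')
    (Q : probability T' R) (M L : T' -> paths {nonneg R} R) c :
  0 < a%:num -> decomposition P Nt a Q M L -> nneg_coef c ->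
  (\int[Q]_w (expR (- pairing c (L w)))%:E =
   \int[P]_w (expR (- pairing c (stopped Nt a w)))%:E)%E.
Proof.
move=> a0 [[mM eqM] mL _ ML eqN] c0.
have eqMa : (\int[Q]_w (expR (- pairing c (M w)))%:E =
    \int[P]_w (expR (- pairing c (after Nt a w)))%:E)%E.
  apply: eq_law_laplace => //; first exact: (measurable_after N a).
  by move=> n t B mB; rewrite eqM// conditional_eq_law_after.
apply: (@mulIe _ (\int[P]_w (expR (- pairing c (after Nt a w)))%:E)%E).
- exact: (laplace_fin_num P (measurable_after N a) c0).
- exact: (laplace_neq0 P (measurable_after N a) c0).
rewrite muleC [RHS]muleC -laplace_after_stopped -eqMa.
rewrite -(indep_integralM (f := fun y => expR (- pairing c y))
  (g := fun y => expR (- pairing c y)) mM mL ML); last 4 first.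
- exact: measurable_expR_pairing.
- by move=> y; exact: expR_ge0.
- exact: measurable_expR_pairing.
- by move=> y; exact: expR_ge0.
rewrite (eq_law_laplace (measurable_poisson_trajectory N) (measurable_padd mM mL) c eqN).
by apply: eq_integral => w _; rewrite pairing_padd opprD expRD.
Qed.

End poisson_decomposition.

(** * Infinite divisibility of the stopped process *)

Section affine_poisson.
Context {R : realType} {d : measure_display} {T : measurableType d}.
Variables (P : probability T R) (lam : R) (N : {nonneg R} -> {RV P >-> nat}).
Hypotheses (ppN : poisson_process lam N).

Definition affine_time (u : {nonneg R}) (r : {posnum R}) (t : {nonneg R}) : {nonneg R} :=
  (u%:num + t%:num * r%:num)%:nng.

Definition affine_poisson u r (t : {nonneg R}) : {RV P >-> nat} :=
  HB.pack (fun w => N (affine_time u r t) w - N u w)%N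
    (isMeasurableFun.Build _ _ _ _ _ (measurable_poissonB N (affine_time u r t) u)).

Lemma affine_time_le u r : {mono affine_time u r : s t / s <= t}.
Proof. by move=> s t; rewrite -!num_le /= lerD2l ler_pM2r. Qed.

Lemma affine_time_lt u r : {mono affine_time u r : s t / s < t}.
Proof. by move=> s t; rewrite -!num_lt /= ltrD2l ltr_pM2r. Qed.

Lemma affine_time_ge u r t : u <= affine_time u r t.
Proof. by rewrite -num_le /= lerDl. Qed.

Lemma affine_poissonB u r s t w : s <= t ->
  (affine_poisson u r t w - affine_poisson u r s w =
   N (affine_time u r t) w - N (affine_time u r s) w)%N.
Proof.
move=> st /=.
have := pp_nondecreasing ppN w (affine_time_ge u r s).
have : (N (affine_time u r s) w <= N (affine_time u r t) w)%N.
  by apply: (pp_nondecreasing ppN); rewrite affine_time_le.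
lia.
Qed.

(** Restarted at u and run at speed r, N is again a Poisson process, of intensity lam r. The formula
    for the stopped process thus applies to each window without a separate computation. *)
Lemma affine_poisson_process u r : poisson_process (lam * r%:num) (affine_poisson u r).
Proof.
split.
- move=> w /=; rewrite (_ : affine_time u r _ = u) ?subnn//.
  by apply/val_inj; rewrite /= mul0r addr0.
- move=> w s t st /=; rewrite leq_sub2r// (pp_nondecreasing ppN)//.
  by rewrite affine_time_le.
- move=> w t; have [e e0 eN] := pp_right_continuous ppN w (affine_time u r t).
  exists (e / r%:num); first by rewrite divr_gt0.
  move=> v tv vt /=; rewrite eN ?affine_time_le//=.
  by move: vt; rewrite -ltrBlDl ltr_pdivlMr// mulrBl ltrBlDl -addrA ltrD2l.
- move=> n t tmono.
  have tmono' : {homo affine_time u r \o t : i j / (i <= j)%N >-> i <= j}.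
    by move=> i j /tmono; rewrite /= affine_time_le.
  have -> : (fun (i : 'I_n) w =>
      (affine_poisson u r (t i.+1) w - affine_poisson u r (t i) w)%N) =
      (fun (i : 'I_n) w =>
        N (affine_time u r (t i.+1)) w - N (affine_time u r (t i)) w)%N.
    apply/funext => i; apply/funext => w.
    by rewrite affine_poissonB//; exact: tmono.
  exact: (pp_indep ppN (n := n) tmono').
- move=> s t st k.
  have st' : affine_time u r s < affine_time u r t by rewrite affine_time_lt.
  rewrite (_ : [set _ | _] = [set w |
      (N (affine_time u r t) w - N (affine_time u r s) w)%N = k]); last first.
    by apply/seteqP; split=> w /=; rewrite affine_poissonB ?ltW.
  rewrite (pp_increment ppN st') !lebesgue_measure_itv /= !lte_fin.
  have st0 : s%:num < t%:num by [].
  rewrite st0 ltrD2l ltr_pM2r// st0 -!EFinB /=.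
  by congr (poisson_pmf _ _)%:E; ring.
Qed.

End affine_poisson.

Section infinite_divisibility.
Context {R : realType} {d : measure_display} {T : measurableType d}.
Variables (P : probability T R) (lam : R) (N : {nonneg R} -> {RV P >-> nat}).
Hypotheses (lam_gt0 : 0 < lam) (ppN : poisson_process lam N).
Variables (a : {nonneg R}) (r : {posnum R}).

Definition window_start (i : nat) : {nonneg R} := (a%:num * r%:num *+ i)%:nng.

(* For r = 1/k, the first k windows are i.i.d. and their sum has the law of N
   stopped at a, so that N itself carries the k-th convolution root. *)
Definition window (i : nat) : T -> paths {nonneg R} R :=
  stopped (fun t => affine_poisson N (window_start i) r t : T -> nat) a.

Lemma measurable_window i : measurable_fun setT (window i).
Proof. exact: measurable_stopped. Qed.

Lemma window_laplace i (c : seq ({nonneg R} * R)) : nneg_coef c ->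
  (\int[P]_w (expR (- pairing c (window i w)))%:E =
   expeR (- ((lam * r%:num)%:E * step_exponent `[0%R, a%:num] c)))%E.
Proof.
move=> c0; apply: (stopped_laplace _ (affine_poisson_process ppN _ _)) => //.
by rewrite mulr_gt0.
Qed.

(** The functional must send every path to a nonnegative one, whence the absolute value; on
    trajectories of N the difference is already nonnegative. *)
Let past (i : nat) (y : paths {nonneg R} R) : paths {nonneg R} R :=
  fun s => `|(y (affine_time (window_start i) r (Num.min s a)))%:num -
             (y (window_start i))%:num|%:nng.

Let measurable_past i : measurable_fun setT (past i).
Proof.
apply/measurable_pathsP => s; apply: measurableT_comp => //.
by apply: measurable_funB; exact: measurable_eval.
Qed.

Let future (i : nat) (y : paths {nonneg R} R) : paths {nonneg R} R :=
  fun s => y (affine_time (window_start i) r (Num.min s a)).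

Let measurable_future i : measurable_fun setT (future i).
Proof. by apply/measurable_pathsP => s; exact: measurable_eval. Qed.

Let affine_time_window i s :
  affine_time (window_start i) r (Num.min s a) <= window_start i.+1.
Proof.
rewrite -num_le /= mulrSr lerD2l ler_pM2r//.
by rewrite num_le ge_min lexx orbT.
Qed.

Let windowE_past m i w : (i < m)%N ->
  window i w = past i (stopped (fun t => N t : T -> nat) (window_start m) w).
Proof.
move=> im; apply/funext => s; apply/val_inj => /=.
have nim : window_start i.+1 <= window_start m.
  rewrite -num_le /= -[leLHS]mulr_natr -[leRHS]mulr_natr.
  by rewrite ler_wpM2l ?ler_nat ?mulr_ge0.
have ns := le_trans (affine_time_window i s) nim.
have ni : window_start i <= window_start m := le_trans (affine_time_ge _ _ _) ns.
rewrite (min_idPl ns) (min_idPl ni) natrB; last first.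
  by apply: (pp_nondecreasing ppN); exact: affine_time_ge.
rewrite ger0_norm// subr_ge0 ler_nat.
by apply: (pp_nondecreasing ppN); exact: affine_time_ge.
Qed.

Let windowE_future m w :
  window m w = future m (after (fun t => N t : T -> nat) (window_start m) w).
Proof.
apply/funext => s; apply/val_inj => /=.
by rewrite (max_idPl (affine_time_ge _ _ _)).
Qed.

(** Window m is a functional of the path counted from its start, all earlier windows of the path
    stopped there. Independence at that one time detaches the last factor, and induction does the
    rest. *)
Lemma window_product m (f : nat -> paths {nonneg R} R -> R) :
  (forall i, measurable_fun setT (f i)) -> (forall i y, 0 <= f i y) ->
  (\int[P]_w (\prod_(i < m) f i (window i w))%:E =
   \prod_(i < m) \int[P]_w (f i (window i w))%:E)%E.
Proof.
move=> mf f0; elim: m => [|m IH].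
  under eq_integral do rewrite big_ord0.
  rewrite big_ord0 integral_cst// mul1e; exact: probability_setT.
rewrite big_ord_recr /= -IH muleC.
pose F (y : paths {nonneg R} R) := f m (future m y).
pose G (y : paths {nonneg R} R) := \prod_(i < m) f i (past i y).
have FE w : f m (window m w) = F (after (fun t => N t : T -> nat) (window_start m) w).
  by rewrite /F -windowE_future.
have GE w : \prod_(i < m) f i (window i w) =
    G (stopped (fun t => N t : T -> nat) (window_start m) w).
  by rewrite /G; apply: eq_bigr => i _; rewrite -windowE_past.
under [X in (_ = X * _)%E]eq_integral do rewrite FE.
under [X in (_ = _ * X)%E]eq_integral do rewrite GE.
rewrite -(indep_integralM (measurable_after N (window_start m))
  (measurable_stopped N (window_start m)) (after_stopped_indep ppN (window_start m))).
- by apply: eq_integral => w _; rewrite big_ord_recr /= FE GE mulrC.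
- exact: measurableT_comp (mf m) (measurable_future m).
- by move=> y; exact: f0.
- apply: measurable_prod => i _.
  exact: measurableT_comp (mf i) (measurable_past i).
- by move=> y; apply: prodr_ge0 => i _; exact: f0.
Qed.

End infinite_divisibility.

Lemma expeR_natM {R : realType} (x : R) (y : \bar R) k : 0 <= x -> (0 <= y)%E ->
  (\prod_(i < k) expeR (- (x%:E * y)) = expeR (- ((x * k%:R)%:E * y)))%E.
Proof.
move=> x0 y0; elim: k => [|k IH].
  by rewrite big_ord0 mulr0 mul0e oppe0 expeR0.
rewrite big_ord_recr /= IH -natr1 mulrDr mulr1 EFinD ge0_muleDl ?lee_fin ?mulr_ge0//.
rewrite oppeD ?expeRD//.
by rewrite ge0_adde_def// inE mule_ge0// lee_fin ?mulr_ge0.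
Qed.

Lemma measurable_sumn d (T : measurableType d) I (s : seq I) (f : I -> T -> nat) :
  (forall i, measurable_fun setT (f i)) ->
  measurable_fun setT (fun w => \sum_(i <- s) f i w)%N.
Proof.
move=> mf; elim: s => [|i s IH].
  by under eq_fun do rewrite big_nil; exact: measurable_cst.
by under eq_fun do rewrite big_cons; exact: measurable_fun_addn.
Qed.

Lemma stopped_infinitely_divisible {R : realType} d (T : measurableType d)
    (P : probability T R) (lam : R) (N : {nonneg R} -> {RV P >-> nat}) a :
  0 < lam -> poisson_process lam N ->
  infinitely_divisible P (stopped (fun t => N t : T -> nat) a).
Proof.
move=> lam_gt0 ppN n t k k0.
have r0 : 0 < (k%:R : R)^-1 by rewrite invr_gt0 ltr0n.
pose r : {posnum R} := PosNum r0.
pose W := window N a r.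
pose X (i : 'I_k) : {RV P >-> n.-tuple R} := HB.pack (fdd (W i) t)
  (isMeasurableFun.Build _ _ _ _ _ (measurable_fdd t (measurable_window N a r i))).
exists d, T, P, X; split.
- move=> B mB.
  (* [window_product] takes functionals indexed by all integers, while B has k entries; the constant
     1 fills the other indices. *)
  pose f j : paths {nonneg R} R -> R :=
    if insub j is Some i then \1_(fdd id t @^-1` B (i : 'I_k)) else cst 1.
  have fE (i : 'I_k) : f i = \1_(fdd id t @^-1` B i) by rewrite /f valK.
  have mf j : measurable_fun setT (f j).
    by rewrite /f; case: insub => [i|]//; apply: measurable_indic; exact: measurable_cylinder.
  have f0 j y : 0 <= f j y by rewrite /f; case: insub => [i|]//=; rewrite ?ler01.
  have := window_product ppN a r k mf f0.
  have mX i : measurable (X i @^-1` B i).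
    by rewrite -[X in measurable X]setTI; exact: (measurable_funP (X i) measurableT _ (mB i)).
  under [in X in _ = X -> _]eq_bigr => i _.
    rewrite (_ : \int[P]_w _ = P (X i @^-1` B i))%E; last first.
      rewrite -[X in P X]setIT -integral_indic//.
      by apply: eq_integral => w _; rewrite fE.
    over.
  move=> <-; rewrite -[X in P X]setIT -integral_indic//; last first.
    by apply: fin_bigcap_measurable => // i _; exact: mX.
  apply: eq_integral => w _; congr EFin.
  under [RHS]eq_bigr do rewrite fE.
  rewrite indicE; case: (asboolP ((\bigcap_(i in [set: 'I_k]) (X i @^-1` B i)) w)) => h.
    rewrite mem_set// big1// => i _; rewrite indicE mem_set//; exact: (h i I).
  rewrite memNset//.
  have [i Bi] : exists i, ~ B i (X i w).
    by apply/existsNP => h'; apply: h => i _; exact: h'.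
  by apply/esym/eqP/prodf_eq0; exists i => //; rewrite indicE memNset.
- move=> i j B mB; apply: (laplace_eq_law (measurable_window N a r i)
    (measurable_window N a r j)) mB => c c0.
  by rewrite !(window_laplace lam_gt0 ppN).
- pose S := trajectory (fun s w => \sum_(i < k)
    affine_poisson N (window_start a r i) r (Num.min s a) w)%N.
  have mS : measurable_fun setT S.
    by apply: measurable_trajectory => s; apply: measurable_sumn => i.
  have SE w j : tnth (fdd S t w) j = \sum_(i < k) tnth (X i w) j.
    by rewrite tnth_mktuple /= natr_sum; apply: eq_bigr => i _; rewrite tnth_mktuple.
  have lawS : eq_law P S P (stopped (fun t => N t : T -> nat) a).
    apply: (laplace_eq_law mS (measurable_stopped N a)) => c c0.
    rewrite (stopped_laplace lam_gt0 ppN)//.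
    (* Each window contributes intensity lam / k on [0,a], so k of them restore lam. *)
    have lamE : lam = lam * r%:num * k%:R by rewrite /= mulfVK// pnatr_eq0 -lt0n.
    rewrite [in RHS]lamE -expeR_natM ?step_exponent_ge0// ?mulr_ge0 ?(ltW lam_gt0)//.
    under [RHS]eq_bigr => i _ do rewrite -(window_laplace lam_gt0 ppN a r i c0).
    rewrite -(window_product ppN a r k (f := fun _ y => expR (- pairing c y))); last 2 first.
    - by move=> _; exact: measurable_expR_pairing.
    - by move=> _ y; exact: expR_ge0.
    apply: eq_integral => w _; rewrite -expR_sum; congr (expR _)%:E.
    rewrite sumrN; congr (- _).
    rewrite /pairing exchange_big /=; apply: eq_bigr => p _.
    by rewrite natr_sum mulr_sumr.
  move=> B mB; rewrite -(lawS n t B mB).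
  congr (P _); apply/seteqP; split=> w; rewrite /= (_ : [tuple _ | _ < n] = fdd S t w)//;
    by apply/eq_from_tnth => j; rewrite SE tnth_mktuple.
Qed.

(** * Size-biased uniform times *)

Section linear_change_of_variable.
Context {R : realType}.

(** For y > 0, Lebesgue measure is y times its image under u |-> u y, as one checks on half-open
    intervals. The case y = 0 is included because Y may vanish; both sides are then 0. *)
Lemma integral_itv0_scale (y : R) (G : R -> \bar R) : 0 <= y ->
  measurable_fun setT G -> (forall s, (0 <= G s)%E) ->
  (y%:E * \int[lebesgue_measure]_(u in `[0%R, 1%R]) G (u * y)%R =
   \int[lebesgue_measure]_(s in `[0%R, y]) G s)%E.
Proof.
rewrite le_eqVlt => /predU1P[<-|y0] mG G0.
  by rewrite mul0e set_itv1 integral_set1.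
pose f (u : measurableTypeR R) : measurableTypeR R := u * y.
have mf : measurable_fun setT f by apply: mulrr_measurable.
pose m : {measure set (measurableTypeR R) -> \bar R} :=
  measure_function_pushforward__canonical__measure_function_Measure
    (@lebesgue_measure R) mf.
have mE (A : set (measurableTypeR R)) : measurable A ->
    lebesgue_measure A = mscale (NngNum (ltW y0)) m A.
  apply: lebesgue_measure_unique => _ [[a b] _ <-].
  rewrite [RHS](_ : _ = y%:E * lebesgue_measure (f @^-1` `]a, b]))%E//.
  rewrite (_ : f @^-1` _ = `]a / y, b / y]%classic); last first.
    by apply/seteqP; split=> u /=; rewrite !in_itv/= ltr_pdivrMr// ler_pdivlMr.
  rewrite !lebesgue_measure_itv /= !lte_fin ltr_pM2r ?invr_gt0//.
  case: ifP => _; last by rewrite mule0.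
  by rewrite -!EFinB -EFinM -mulrBl mulrC mulfVK ?gt_eqF.
rewrite [RHS](eq_measure_integral (mscale (NngNum (ltW y0)) m)); last first.
  by move=> A mA _; exact: mE.
have mG' : measurable_fun (`[0, y] : set (measurableTypeR R)) G by exact: measurable_funTS.
rewrite ge0_integral_mscale// ge0_integral_pushforward//.
congr (_ * _)%E; rewrite (_ : f @^-1` _ = `[0, 1]%classic)//.
by apply/seteqP; split=> u /=; rewrite !in_itv/= pmulr_lge0// ger_pMl.
Qed.

End linear_change_of_variable.

Section uniform_law.
Context {R : realType} {d : measure_display} {T : measurableType d}.
Variables (Q : probability T R) (U : {RV Q >-> R}).
Hypothesis UE : has_law Q U (uniform_prob (@ltr01 R)).

Lemma integral_uniform_law (f : R -> \bar R) : measurable_fun setT f ->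
  (forall u, (0 <= f u)%E) ->
  (\int[Q]_w f (U w) = \int[lebesgue_measure]_(u in `[0%R, 1%R]) f u)%E.
Proof.
move=> mf f0.
have mU : measurable_fun setT (U : T -> measurableTypeR R) := measurable_funP U.
pose V : {RV Q >-> measurableTypeR R} := HB.pack (U : T -> measurableTypeR R)
  (isMeasurableFun.Build _ _ _ _ _ mU).
transitivity (\int[distribution Q V]_u f u)%E.
  by rewrite ge0_integral_distribution.
transitivity (\int[uniform_prob (@ltr01 R)]_u f u)%E.
  by apply: eq_measure_integral => A mA _; exact: (UE mA).
by rewrite integral_uniform// subr0 invr1 mul1e.
Qed.

End uniform_law.

Section tail.
Context {R : realType} {d : measure_display} {T : measurableType d}.
Variables (Q : probability T R) (Y : {RV Q >-> R}).

Lemma measurable_superlevel (s : R) : measurable [set w | s <= Y w].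
Proof.
have -> : [set w | s <= Y w] = setT `&` Y @^-1` `[s, +oo[%classic.
  by rewrite setTI; apply/seteqP; split=> w /=; rewrite in_itv/= andbT.
exact: (measurable_funP Y measurableT _ (measurable_itv _)).
Qed.

Lemma fin_num_tail (s : R) : Q [set w | s <= Y w] \is a fin_num.
Proof. exact: fin_num_measure (measurable_superlevel s). Qed.

Lemma tail_nonincreasing (s t : R) : s <= t ->
  fine (Q [set w | t <= Y w]) <= fine (Q [set w | s <= Y w]).
Proof.
move=> st; rewrite -lee_fin !fineK ?fin_num_tail//.
apply: le_measure; rewrite ?inE; try exact: measurable_superlevel.
by move=> w /=; exact: le_trans.
Qed.

End tail.

Section size_biased_uniform.
Context {R : realType} {d : measure_display} {T : measurableType d}.
Variables (Q : probability T R) (U Y : {RV Q >-> R}).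
Hypotheses (UE : has_law Q U (uniform_prob (@ltr01 R))) (UY : indep Q U Y).
Hypothesis Y_ge0 : \forall w \ae Q, 0 <= Y w.

Let mU : measurable_fun setT (U : T -> R) := measurable_funP U.
Let mY : measurable_fun setT (Y : T -> R) := measurable_funP Y.

(* Given Y, the variable U Y is uniform on [0, Y], so that Y cancels its density. *)
Lemma integral_size_biased (G : R -> R) : measurable_fun setT G ->
  (forall s, 0 <= G s) ->
  (\int[Q]_w (Y w * G (U w * Y w))%:E =
   \int[lebesgue_measure]_(s in `]0%R, +oo[) (Q [set w | (s <= Y w)%R] * (G s)%:E))%E.
Proof.
move=> mG G0.
(* Y is nonnegative only almost everywhere; its positive part makes the integrand nonnegative at
   every point, as the independence formula requires. *)
pose f (z : R * R) : \bar R := (Num.max z.1 0 * G (z.2 * Num.max z.1 0))%:E.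
have mmax : measurable_fun setT (fun z : R * R => Num.max z.1 0).
  by apply: measurable_maxr => //; exact: measurable_fst.
have mf : measurable_fun setT f.
  apply/measurable_EFinP/measurable_funM => //.
  by apply: measurableT_comp mG _; apply: measurable_funM.
have f0 z : (0 <= f z)%E by rewrite lee_fin mulr_ge0// le_max lexx orbT.
have YU : indep Q Y U by move=> A B mA mB; rewrite setIC UY// muleC.
transitivity (\int[Q]_w f (Y w, U w))%E.
  apply: ae_eq_integral => //.
  - apply/measurable_EFinP/measurable_funM => //.
    by apply: measurableT_comp mG _; exact: measurable_funM.
  - apply: (measurableT_comp mf); exact/measurable_fun_pairP.
  - by apply: filterS Y_ge0 => w Yw _; rewrite /f /= (max_idPl Yw).
rewrite (indep_integral mY mU YU mf f0).
(* The domain ]0, Y] becomes the joint condition 0 < s <= Y, so that exchanging the integrals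
   produces the tail P[Y >= s]. *)
pose k (z : T * R) : \bar R :=
  if (0 < z.2) && (z.2 <= Y z.1) then (G z.2)%:E else 0%E.
have mk : measurable_fun setT k.
  apply: measurable_fun_if => //.
  - apply: measurable_and.
      by apply: measurable_fun_ltr => //; exact: measurable_snd.
    apply: measurable_fun_ler; first exact: measurable_snd.
    exact: measurableT_comp mY measurable_fst.
  - apply: measurable_funTS; apply/measurable_EFinP.
    exact: measurableT_comp mG measurable_snd.
have k0 z : (0 <= k z)%E by rewrite /k; case: ifP => //; rewrite lee_fin.
transitivity (\int[Q]_w \int[lebesgue_measure]_s k (w, s))%E.
  apply: eq_integral => w _.
  pose y := Num.max (Y w) 0.
  have y0 : 0 <= y by rewrite /y le_max lexx orbT.
  have mGE : measurable_fun setT (EFin \o G) by exact/measurable_EFinP.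
  rewrite (integral_uniform_law UE (f := fun u => f (Y w, u))); last 2 first.
  - by apply: (measurableT_comp mf); exact: pair1_measurable.
  - by move=> u; exact: f0.
  rewrite -[RHS](_ : (\int[lebesgue_measure]_(s in `]0%R, y]) (G s)%:E)%E = _); last first.
    rewrite integral_mkcond; apply: eq_integral => s _; rewrite patchE mem_setE in_itv /k /=.
    rewrite /y le_max; have [s0|s0] := ltP 0 s; last by rewrite andFb.
    by rewrite orbF.
  rewrite integral_itv_obnd_cbnd; last exact: measurable_funTS.
  rewrite -(integral_itv0_scale y0 mGE)//.
  rewrite -ge0_integralZl//.
  - apply: measurable_funTS; apply: measurableT_comp mGE _; exact: mulrr_measurable.
  - by move=> u _; rewrite lee_fin.
rewrite (@fubini_tonelli _ _ _ _ _ Q lebesgue_measure k mk k0).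
rewrite [RHS]integral_mkcond; apply: eq_integral => s _.
rewrite patchE mem_setE in_itv /= andbT /k /=; case: ifPn => s0; last first.
  by rewrite integral0.
have mYs := measurable_superlevel Y s.
rewrite muleC -[in RHS](setIT [set w | s <= Y w]) -integral_indic// -ge0_integralZl//.
- apply: eq_integral => w _; rewrite indicE /=.
  case: ifPn => [sY|/negP sY]; first by rewrite mem_set// mule1.
  by rewrite memNset// mule0.
- exact/measurable_EFinP/measurable_indic.
- by rewrite lee_fin.
Qed.

(** On ]0,oo[ the density g is the reciprocal of the tail and cancels it. Leaving g abstract treats
    1/P[Y >= x] and the exponential case together. *)
Lemma integral_size_biased_step (g : R -> R)
    (F : paths {nonneg R} R -> R) :
  measurable_fun setT g -> (forall s, 0 <= g s) ->
  (forall s, 0 < s -> Q [set w | s <= Y w] = (g s)^-1%:E) ->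
  (forall s, 0 < s -> g s != 0) ->
  measurable_fun setT F -> (forall y, 0 <= F y) ->
  ('E_Q[fun w => (Y w * g (U w * Y w) * F (step (U w * Y w)))%R] =
   \int[lebesgue_measure]_(s in `]0%R, +oo[) (F (step s))%:E)%E.
Proof.
move=> mg g0 gE gn0 mF F0; rewrite unlock.
have mFs : measurable_fun setT (fun s : measurableTypeR R => F (step s)).
  exact: measurableT_comp mF measurable_step.
under eq_integral do rewrite -mulrA.
rewrite (integral_size_biased (G := fun s => g s * F (step s))).
- apply: eq_integral => s; rewrite inE/= in_itv/= andbT => s0.
  by rewrite gE// -EFinM mulrA mulVf ?mul1r// gn0.
- exact: measurable_funM.
- by move=> s; rewrite mulr_ge0.
Qed.

End size_biased_uniform.

(** * Differentiation in b and the size-biased process *)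

Section difference_quotient.
Context {R : realType}.
Implicit Type x : R.

(* (1 - e^(-b x)) / b at b = 2^-n; along this sequence it increases to x. *)
Definition dyadic_quotient (n : nat) x : R := (1 - expR (- (2^-1 ^+ n * x))) / 2^-1 ^+ n.

Let q_gt0 n : 0 < 2^-1 ^+ n :> R.
Proof. by rewrite exprn_gt0. Qed.

Lemma dyadic_quotient_ge0 n x : 0 <= x -> 0 <= dyadic_quotient n x.
Proof.
move=> x0; rewrite divr_ge0 ?(ltW (q_gt0 n))//.
by have /andP[] := @expR_sub01 R (2^-1 ^+ n * x) (mulr_ge0 (ltW (q_gt0 n)) x0).
Qed.

(** Halving b replaces e^2 by e = e^(-b x / 2), and the claim reduces to 1 - e^2 <= 2 (1 - e), that
    is (1 - e)^2 >= 0. *)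
Lemma dyadic_quotient_nd x : 0 <= x ->
  {homo dyadic_quotient^~ x : n m / (n <= m)%N >-> n <= m}.
Proof.
move=> x0; apply: homo_leq => [//|n m p|n]; first exact: le_trans.
rewrite /dyadic_quotient exprSr.
set q : R := 2^-1 ^+ n; have q0 : 0 < q := q_gt0 n.
set e := expR (- (q * 2^-1 * x)).
have -> : expR (- (q * x)) = e * e.
  by rewrite /e -expRD; congr expR; field.
have /andP[e0 e1] : 0 <= 1 - e <= 1 by apply: expR_sub01; rewrite !mulr_ge0// ltW.
rewrite invfM invrK mulrA (mulrAC (1 - e)) ler_wpM2r ?invr_ge0 ?(ltW q0)//.
by nra.
Qed.

(** From e^(-v) <= 1/(1+v) one gets 1 - e^(-v) >= v/(1+v), which is at least v - v^2. *)
Lemma quotient_bounds (v : R) : 0 <= v -> v - v ^+ 2 <= 1 - expR (- v) <= v.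
Proof.
move=> v0; apply/andP; split; last first.
  by have := expR_ge1Dx (- v); lra.
have ev : expR (- v) * (1 + v) <= 1.
  by rewrite expRN mulrC ler_pdivrMr ?expR_gt0// mul1r expR_ge1Dx.
have := expR_ge0 (- v); nra.
Qed.

Lemma cvg_half : (2^-1 ^+ n : R) @[n --> \oo] --> (0 : R).
Proof. by apply: cvg_expr; rewrite ger0_norm// invf_lt1// ltr1n. Qed.

(** Stated for a general sequence because it is used on both sides of the differentiation: with v n
    = 2^-n x inside the expectation, and with v n the change of the Laplace exponent outside. *)
Lemma cvg_quotient (v : nat -> R) (x : R) : (forall n, 0 <= v n) ->
  v n / 2^-1 ^+ n @[n --> \oo] --> x ->
  (1 - expR (- v n)) / 2^-1 ^+ n @[n --> \oo] --> x.
Proof.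
move=> v0 vx.
apply: (@squeeze_cvgr _ _ _ _
  (fun n => v n / 2^-1 ^+ n - (v n / 2^-1 ^+ n) ^+ 2 * 2^-1 ^+ n)
  (fun n => v n / 2^-1 ^+ n)) => //.
- near=> n; have /andP[l u] := quotient_bounds (v0 n).
  have q0 := q_gt0 n.
  rewrite ler_wpM2r ?invr_ge0 ?(ltW q0)// andbT.
  have -> : v n / 2^-1 ^+ n - (v n / 2^-1 ^+ n) ^+ 2 * 2^-1 ^+ n =
    (v n - v n ^+ 2) / 2^-1 ^+ n by field; rewrite gt_eqF.
  by rewrite ler_wpM2r ?invr_ge0 ?(ltW q0).
- rewrite -[X in _ --> X]subr0; apply: cvgB => //.
  rewrite -(mulr0 (x ^+ 2)); apply: cvgM; last exact: cvg_half.
  by rewrite expr2; apply: cvgM.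
Unshelve. all: by end_near.
Qed.

Lemma cvg_dyadic_quotient x : 0 <= x ->
  dyadic_quotient n x @[n --> \oo] --> x.
Proof.
move=> x0; apply: cvg_quotient.
  by move=> n; rewrite mulr_ge0// ltW.
have -> : (fun n => 2^-1 ^+ n * x / 2^-1 ^+ n) = cst x.
  by apply/funext => n; rewrite mulrAC divff ?mul1r// gt_eqF.
exact: cvg_cst.
Qed.

End difference_quotient.

Section size_biased_poisson.
Context {R : realType} {d : measure_display} {T : measurableType d}.
Variables (P : probability T R) (lam : R) (N : {nonneg R} -> {RV P >-> nat}).
Hypotheses (lam_gt0 : 0 < lam) (ppN : poisson_process lam N).
Variable a : {nonneg R}.
Implicit Type c : seq ({nonneg R} * R).
Let Nt := (fun t => N t : T -> nat).

(** Up to the factor 1/a, the Laplace functional of a step at a uniform time in [0,a]. *)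
Definition step_laplace c : \bar R :=
  (\int[lebesgue_measure]_(s in `[0%R, a%:num]) (expR (- pairing c (step s)))%:E)%E.

Let measurable_step_laplace c : measurable_fun setT
  (fun s : measurableTypeR R => (expR (- pairing c (step s)))%:E).
Proof.
apply/measurable_EFinP.
exact: (measurableT_comp (measurable_expR_pairing c) measurable_step).
Qed.

Lemma step_laplace_ge0 c : (0 <= step_laplace c)%E.
Proof. by apply: integral_ge0 => s _; rewrite lee_fin expR_ge0. Qed.

Lemma step_laplace_fin_num c : nneg_coef c -> step_laplace c \is a fin_num.
Proof.
move=> c0; rewrite ge0_fin_numE ?step_laplace_ge0//.
apply: (@le_lt_trans _ _ (\int[lebesgue_measure]_(s in `[0%R, a%:num]) cst 1%E s)%E).
  apply: ge0_le_integral => //.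
  - by apply: measurable_funTS; exact: measurable_step_laplace.
  - by move=> s _; rewrite lee_fin; have /andP[] := expR_pairing01 (step s) c0.
rewrite integral_cst// mul1e.
suff : (lebesgue_measure `[0%R, a%:num]%classic < +oo)%E by [].
rewrite lebesgue_measure_itv /= lte_fin.
by case: ifP => _; rewrite -?EFinB ltry.
Qed.

(** For s <= a the extra mass adds (1 - e^(-b)) e^(-<c,1_[s,oo)>) to the integrand, and for s > a
    nothing. No order is assumed between a and the times of c, and b is isolated in one factor whose
    derivative at 0 is 1. *)
Lemma step_exponent_cons_laplace c (b : R) : 0 <= b -> nneg_coef c ->
  (step_exponent `]0%R, +oo[ ((a, b) :: c) =
   step_exponent `]0%R, +oo[ c + (1 - expR (- b))%:E * step_laplace c)%E.
Proof.
move=> b0 c0; have /andP[B0 _] := expR_sub01 b0.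
rewrite /step_laplace -integral_itv_obnd_cbnd; last first.
  by apply: measurable_funTS; exact: measurable_step_laplace.
rewrite -ge0_integralZl//; last first.
  by apply: measurable_funTS; exact: measurable_step_laplace.
have -> : (\int[lebesgue_measure]_(s in `]0%R, a%:num])
    ((1 - expR (- b))%:E * (expR (- pairing c (step s)))%:E) =
  \int[lebesgue_measure]_(s in `]0%R, +oo[)
    ((1 - expR (- b)) * (expR (- pairing c (step s)) * (s <= a%:num)%R%:R))%:E)%E.
  rewrite integral_mkcond [RHS]integral_mkcond; apply: eq_integral => s _.
  rewrite !patchE !mem_setE !in_itv /= andbT.
  case: (0 < s) => //=.
  by case: (s <= a%:num); rewrite ?mulr1 ?mulr0.
rewrite /step_exponent -ge0_integralD//; last 4 first.
- by move=> s _; exact: step_exponent_integrand_ge0.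
- by apply: measurable_funTS; exact: measurable_step_exponent.
- by move=> s _; rewrite lee_fin !mulr_ge0// expR_ge0.
- apply: measurable_funTS; apply/measurable_EFinP/measurable_funM => //.
  apply: measurable_funM.
    exact: (measurableT_comp (measurable_expR_pairing c) measurable_step).
  rewrite (_ : (fun s => _) = \1_(`]-oo, a%:num])); first exact: measurable_indic.
  by apply/funext => s; rewrite indicE mem_setE in_itv.
apply: eq_integral => s _; rewrite -EFinD; congr EFin.
rewrite pairing_cons /step /= opprD expRD.
by case: (s <= a%:num); rewrite ?mulr1 ?mulr0 ?oppr0 ?expR0; ring.
Qed.

(** Both sides are limits of (E e^(-<c,N>) - E e^(-<c,N> - b N_a)) / b along b = 2^-n. Monotone
    convergence on the left avoids presupposing that N_a is integrable. *)
Lemma size_biased_poisson_laplace c : nneg_coef c ->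
  (\int[P]_w ((N a w)%:R * expR (- pairing c (trajectory Nt w)))%:E =
   \int[P]_w (expR (- pairing c (trajectory Nt w)))%:E * (lam%:E * step_laplace c))%E.
Proof.
move=> c0.
have mtr := measurable_poisson_trajectory N.
have mexp (c' : seq ({nonneg R} * R)) : measurable_fun setT
    (fun w => expR (- pairing c' (trajectory Nt w))).
  exact: (measurableT_comp (measurable_expR_pairing c') mtr).
have mN : measurable_fun setT (fun w => (N a w)%:R : R) by exact: measurable_fun_natr.
have mdq n : measurable_fun setT (fun w => dyadic_quotient n (N a w)%:R : R).
  apply: measurable_funM => //; apply: measurable_funB => //.
  apply: measurableT_comp => //; apply: measurableT_comp => //.
  exact: measurable_funM.
pose g n w := (dyadic_quotient n (N a w)%:R * expR (- pairing c (trajectory Nt w)))%:E.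
have cvg_g : (\int[P]_w g n w @[n --> \oo] -->
    \int[P]_w ((N a w)%:R * expR (- pairing c (trajectory Nt w)))%:E)%E.
  have -> : (\int[P]_w ((N a w)%:R * expR (- pairing c (trajectory Nt w)))%:E =
      \int[P]_w limn (g ^~ w))%E.
    apply: eq_integral => w _; apply/esym/cvg_lim => //.
    apply: cvg_EFin; first by near=> n.
    apply: cvgM; last exact: cvg_cst.
    exact: cvg_dyadic_quotient.
  apply: cvg_monotone_convergence => //.
  - by move=> n; apply/measurable_EFinP/measurable_funM.
  - by move=> n w _; rewrite lee_fin mulr_ge0 ?expR_ge0 ?dyadic_quotient_ge0.
  - move=> w _ n m nm; rewrite lee_fin ler_wpM2r ?expR_ge0//.
    exact: dyadic_quotient_nd.
have kfin := laplace_fin_num P mtr c0.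
have Cfin := step_laplace_fin_num c0.
set K := (\int[P]_w (expR (- pairing c (trajectory Nt w)))%:E)%E in kfin *.
set C := step_laplace c in Cfin *.
(* The change of exponent caused by the mass 2^-n at a: the perturbed Laplace functional is K e^(-v
   n). *)
pose v n : R := lam * (1 - expR (- 2^-1 ^+ n)) * fine C.
have C0 : 0 <= fine C by apply: fine_ge0; exact: step_laplace_ge0.
have q0 n : 0 <= 2^-1 ^+ n :> R by rewrite exprn_ge0.
have v0 n : 0 <= v n.
  have /andP[? _] := @expR_sub01 R _ (q0 n).
  by rewrite !mulr_ge0// ltW.
have int_g n : (\int[P]_w g n w = (fine K * ((1 - expR (- v n)) / 2^-1 ^+ n))%:E)%E.
  have nn : nneg_coef ((a, 2^-1 ^+ n) :: c) by rewrite /= q0.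
  have ii (c' : seq ({nonneg R} * R)) : nneg_coef c' -> P.-integrable setT
      (fun w => (expR (- pairing c' (trajectory Nt w)))%:E).
    move=> c'0; apply: (eq_integrable measurableT
      (fun w => (cst 1 w * expR (- pairing c' (trajectory Nt w)))%:E)).
      by move=> w _; rewrite /= mul1r.
    apply: integrable_mul01 => //.
    - exact: finite_measure_integrable_cst.
    - by move=> w; exact: expR_pairing01.
  have -> : (\int[P]_w g n w = \int[P]_w ((2^-1 ^- n)%:E *
      ((expR (- pairing c (trajectory Nt w)))%:E -
       (expR (- pairing ((a, 2^-1 ^+ n) :: c) (trajectory Nt w)))%:E)))%E.
    apply: eq_integral => w _; rewrite -EFinB -EFinM /g; congr EFin.
    by rewrite pairing_cons opprD expRD /dyadic_quotient /trajectory /Nt /=; ring.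
  rewrite integralZl//; last by apply: integrableB => //; exact: ii.
  rewrite integralB//; [|exact: ii|exact: ii].
  have -> : (\int[P]_w (expR (- pairing ((a, 2^-1 ^+ n) :: c) (trajectory Nt w)))%:E =
      K * (expR (- v n))%:E)%E.
    have /andP[B0 _] := @expR_sub01 R _ (q0 n).
    rewrite (poisson_process_laplace lam_gt0 ppN nn) step_exponent_cons_laplace//.
    rewrite -/C -(fineK Cfin) -EFinM ge0_muleDr ?step_exponent_ge0//; last first.
      by rewrite lee_fin mulr_ge0.
    rewrite -EFinM fin_num_oppeD// expeRD -(poisson_process_laplace lam_gt0 ppN c0).
    by rewrite /v /= mulrA.
  by rewrite -/K -(fineK kfin) -!EFinM; congr EFin => /=; ring.
move: cvg_g; rewrite (funext int_g) => cvg_g.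
apply: (@cvg_unique _ _ _ _ _ _ cvg_g) => //.
rewrite -(fineK kfin) -(fineK Cfin) -!EFinM; apply: cvg_EFin; first by near=> n.
apply: cvgM; first exact: cvg_cst.
apply: cvg_quotient => //.
have -> : (fun n => v n / 2^-1 ^+ n) = (fun n => lam * fine C * dyadic_quotient n 1).
  by apply/funext => n; rewrite /v /dyadic_quotient mulr1; ring.
rewrite -[X in _ --> X]mulr1; apply: cvgM; first exact: cvg_cst.
exact: cvg_dyadic_quotient.
Unshelve. all: by end_near.
Qed.

Lemma uniform_step_laplace (U : {RV P >-> R}) c : 0 < a%:num ->
  has_law P U (uniform_prob (@ltr01 R)) ->
  (\int[P]_w (expR (- pairing c (step (a%:num * U w))))%:E =
   (a%:num^-1)%:E * step_laplace c)%E.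
Proof.
move=> a0 UE.
have mf : measurable_fun setT (fun s : R => (expR (- pairing c (step s)))%:E).
  exact: measurable_step_laplace.
rewrite (integral_uniform_law UE
  (f := fun u => (expR (- pairing c (step (a%:num * u))))%:E)).
- rewrite /step_laplace -(integral_itv0_scale (ltW a0) mf).
    rewrite muleA -EFinM mulVf ?gt_eqF// mul1e.
    by apply: eq_integral => u _; rewrite mulrC.
  by move=> s; rewrite lee_fin expR_ge0.
- by apply: (measurableT_comp mf); exact: mulrl_measurable.
- by move=> u; rewrite lee_fin expR_ge0.
Qed.

Lemma size_biased_poisson (U : {RV P >-> R}) : 0 < a%:num ->
  has_law P U (uniform_prob (@ltr01 R)) ->
  indep P U (trajectory Nt) ->
  eq_law P (fun w => padd (trajectory Nt w) (step (a%:num * U w)))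
    (weighted P (fun w => (N a w)%:R / (lam * a%:num))) (trajectory Nt).
Proof.
move=> a0 UE UN n t B mB.
have mtr := measurable_poisson_trajectory N.
have mU : measurable_fun setT (U : T -> R) := measurable_funP U.
have maU : measurable_fun setT (fun w => step (a%:num * U w)).
  apply: (measurableT_comp measurable_step); exact: measurable_funM.
have mX := measurable_padd mtr maU.
pose A := fdd id t @^-1` B : set (paths {nonneg R} R).
have mA : measurable A := measurable_cylinder t mB.
have la0 : 0 < lam * a%:num by rewrite mulr_gt0.
have Z0 w : 0 <= (N a w)%:R / (lam * a%:num) by rewrite divr_ge0// ltW.
have mZ : measurable_fun setT (fun w => (N a w)%:R / (lam * a%:num)).
  by apply: measurable_funM => //; exact: measurable_fun_natr.
have mexp (c' : seq ({nonneg R} * R)) : measurable_fun setT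
    (fun w => expR (- pairing c' (trajectory Nt w))).
  exact: (measurableT_comp (measurable_expR_pairing c') mtr).
have ZL c : nneg_coef c ->
    (\int[P]_w ((N a w)%:R / (lam * a%:num) * expR (- pairing c (trajectory Nt w)))%:E =
     \int[P]_w (expR (- pairing c (trajectory Nt w)))%:E *
       ((a%:num^-1)%:E * step_laplace c))%E.
  move=> c0; transitivity (((lam * a%:num)^-1)%:E *
      \int[P]_w ((N a w)%:R * expR (- pairing c (trajectory Nt w)))%:E)%E.
    rewrite -ge0_integralZl//.
    - by apply: eq_integral => w _; rewrite -EFinM; congr EFin; ring.
    - apply/measurable_EFinP/measurable_funM => //; exact: measurable_fun_natr.
    - by rewrite lee_fin invr_ge0 ltW.
  rewrite size_biased_poisson_laplace// muleCA; congr (_ * _)%E.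
  by rewrite muleA -EFinM invfM mulrAC mulVf ?mul1r// gt_eqF.
(* At the empty list the identity [ZL] expresses the mean of the weight as a product of finite
   numbers, which yields its integrability. *)
have iZ : P.-integrable setT (EFin \o (fun w => (N a w)%:R / (lam * a%:num))).
  apply/integrableP; split; first exact/measurable_EFinP.
  have -> : (\int[P]_w `|((N a w)%:R / (lam * a%:num))%:E| =
      \int[P]_w ((N a w)%:R / (lam * a%:num) *
        expR (- pairing [::] (trajectory Nt w)))%:E)%E.
    apply: eq_integral => w _.
    by rewrite /pairing big_nil oppr0 expR0 mulr1 /= ger0_norm.
  rewrite ZL//= ltey; apply: contraTneq (isT) => h.
  have f1 := laplace_fin_num P mtr (isT : nneg_coef [::]).
  have f2 := step_laplace_fin_num (isT : nneg_coef [::]).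
  have : (\int[P]_w (expR (- pairing [::] (trajectory Nt w)))%:E *
       ((a%:num^-1)%:E * step_laplace [::]))%E \is a fin_num by rewrite !fin_numM.
  by rewrite h.
transitivity (\int[P]_(w in (fun w => padd (trajectory Nt w) (step (a%:num * U w))) @^-1` A)
    (cst 1 w)%:E)%E.
  have mXA : measurable ((fun w => padd (trajectory Nt w) (step (a%:num * U w))) @^-1` A).
    by rewrite -[X in measurable X]setTI; exact: mX.
  by have := integral_cst P mXA 1%E; rewrite mul1e => ->.
apply: (laplace_unique mX mtr) => //.
- exact: finite_measure_integrable_cst.
- move=> c c0; rewrite ZL// -(uniform_step_laplace c a0 UE) muleC.
  rewrite -(indep_integralM (X := U : T -> R)
    (f := fun u => expR (- pairing c (step (a%:num * u))))
    (g := fun y => expR (- pairing c y)) mU mtr UN).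
  + by apply: eq_integral => w _; rewrite mul1r pairing_padd opprD expRD mulrC.
  + apply: (measurableT_comp (measurable_expR_pairing c)).
    apply: (measurableT_comp measurable_step); exact: mulrl_measurable.
  + by move=> u; exact: expR_ge0.
  + exact: measurable_expR_pairing.
  + by move=> y; exact: expR_ge0.
Qed.

End size_biased_poisson.

(** * The Levy measure of N and its representations *)

Section levy_measure_of_poisson.
Context {R : realType} {d : measure_display} {T : measurableType d}.
Variables (P : probability T R) (lam : R) (N : {nonneg R} -> {RV P >-> nat}).
Hypotheses (lam_gt0 : 0 < lam) (ppN : poisson_process lam N).
Let Nt := (fun t => N t : T -> nat).

Lemma levy_measure_given_by_ext {E : Type} (psi : T -> paths E R)
    (Phi Psi : (paths E R -> R) -> \bar R) :
  (forall F : paths E R -> R, measurable_fun setT F -> (forall y, 0 <= F y) ->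
    Phi F = Psi F) ->
  levy_measure_given_by P psi Phi -> levy_measure_given_by P psi Psi.
Proof.
move=> PhiPsi [nuE nuU]; split=> // nu levy F mF F0.
by rewrite -PhiPsi//; exact: nuU.
Qed.

Lemma poisson_levy_measure : levy_measure_given_by P (trajectory Nt) (fun F =>
  lam%:E * \int[lebesgue_measure]_(s in `]0%R, +oo[) (F (step s))%:E)%E.
Proof.
apply: (step_levy_measure_given_by (l := NngNum (ltW lam_gt0))
  (measurable_poisson_trajectory N)) => // c c0.
by rewrite unlock; exact: poisson_process_laplace.
Qed.

Section representation.
Context {d' : measure_display} {T' : measurableType d'}.
Variables (Q : probability T' R) (U Y : {RV Q >-> R}).
Hypotheses (UE : has_law Q U (uniform_prob (@ltr01 R))) (UY : indep Q U Y).

Lemma poisson_levy_measure_size_biased (g : R -> R) :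
  (\forall w \ae Q, 0 <= Y w) ->
  measurable_fun setT g -> (forall s, 0 <= g s) ->
  (forall s, 0 < s -> Q [set w | s <= Y w] = (g s)^-1%:E) ->
  (forall s, 0 < s -> g s != 0) ->
  levy_measure_given_by P (trajectory Nt) (fun F =>
    lam%:E * 'E_Q[fun w => (Y w * g (U w * Y w) * F (step (U w * Y w)))%R])%E.
Proof.
move=> Y0 mg g0 gE gn0; apply: levy_measure_given_by_ext poisson_levy_measure.
by move=> F mF F0; rewrite (integral_size_biased_step UE UY Y0 mg g0 gE gn0 mF F0).
Qed.

Lemma law_support_tail (x : R) : law_support Q Y = `[0, +oo[%classic ->
  (0 < Q [set w | (x <= Y w)%R])%E.
Proof.
move=> suppY; pose z := Num.max x 0 + 1.
have : law_support Q Y z.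
  by rewrite suppY /= in_itv /= andbT addr_ge0// le_max lexx orbT.
move=> /(_ 1 ltr01) /lt_le_trans; apply; apply: le_measure; rewrite ?inE.
- have := measurable_funP Y measurableT _ (measurable_ball z 1).
  by rewrite setTI.
- exact: measurable_superlevel.
- move=> w /=; rewrite /ball /= => zY.
  have xz : x <= z - 1 by rewrite /z addrK le_max lexx.
  apply: (le_trans xz); move: zY; rewrite ltr_norml => /andP[_].
  by rewrite ltrBlDl addrC -ltrBlDl => /ltW.
Qed.

Lemma exponential_ge0 : has_law Q Y (exponential_prob 1) -> \forall w \ae Q, 0 <= Y w.
Proof.
move=> YE; exists (Y @^-1` `]-oo, 0[); split.
- rewrite -[X in measurable X]setTI.
  by apply: (measurable_funP Y measurableT); exact: measurable_itv.
- rewrite YE; last exact: measurable_itv.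
  rewrite /exponential_prob integral0_eq// => x /=; rewrite in_itv/= => x0.
  by rewrite lt0_exponential_pdf.
- by move=> w /= /negP; rewrite -ltNge in_itv.
Qed.

Lemma exponential_tail (s : R) : has_law Q Y (exponential_prob 1) -> 0 < s ->
  Q [set w | s <= Y w] = (expR s)^-1%:E.
Proof.
move=> YE s0.
have mY : measurable (Y @^-1` `]-oo, s[).
  rewrite -[X in measurable X]setTI.
  by apply: (measurable_funP Y measurableT); exact: measurable_itv.
have -> : [set w | s <= Y w] = ~` (Y @^-1` `]-oo, s[).
  by apply/seteqP; split=> w /=; rewrite in_itv/= leNgt => /negP.
rewrite probability_setC// YE; last exact: measurable_itv.
have mpdf (D : set (measurableTypeR R)) : measurable_fun D (EFin \o exponential_pdf 1).
  by apply/measurable_EFinP; apply: measurable_funTS; exact: measurable_exponential_pdf.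
rewrite /exponential_prob.
have -> : `]-oo, s[%classic = `]-oo, 0[%classic `|` `[0, s[%classic :> set R.
  by rewrite -itv_bndbnd_setU// bnd_simp ltW.
rewrite ge0_integral_setU//=; last 2 first.
- by move=> x _; rewrite lee_fin exponential_pdf_ge0.
- apply/disj_setPS => x [] /=; rewrite !in_itv/= => x0 /andP[/le_lt_trans].
  by move=> /(_ _ x0); rewrite ltxx.
rewrite integral0_eq ?add0e; last first.
  by move=> x /=; rewrite in_itv/= => x0; rewrite lt0_exponential_pdf.
rewrite integral_itv_bndo_bndc; last exact: mpdf.
rewrite [X in (_ - X)%E](exponential_prob_itv0c 1 s0).
rewrite -expRN mulN1r -!EFinB.
by congr EFin; ring.
Qed.

End representation.

End levy_measure_of_poisson.

Theorem mainTheorem1 (R : realType) (d : measure_display)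
    (T : measurableType d) (P : probability T R) (lam : R) (lam_gt0 : 0 < lam)
    (N : {nonneg R} -> {RV P >-> nat}) (ppN : poisson_process lam N) :
  (* (a1) *)
  (forall (a : {nonneg R}) (U : {RV P >-> R}),
     0 < a%:num ->
     has_law P U (uniform_prob (@ltr01 R)) ->
     indep P U (trajectory N) ->
     eq_law P (fun w => padd (trajectory N w) (step (a%:num * U w)))
       (weighted P (fun w => (N a w)%:R / (lam * a%:num))) (trajectory N)) /\
  (* (b1) *)
  (forall (d' : measure_display) (T' : measurableType d')
      (Q : probability T' R) (U Y : {RV Q >-> R}),
     has_law Q U (uniform_prob (@ltr01 R)) ->
     indep Q U Y ->
     ((\forall w \ae Q, 0 <= Y w) ->
      law_support Q Y = `[0, +oo[%classic ->
      ('E_Q[Y] < +oo)%E ->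
      let h (x : R) := (fine (Q [set w | x <= Y w]))^-1 in
      levy_measure_given_by P (trajectory N) (fun F =>
        lam%:E * 'E_Q[fun w =>
                       (Y w * h (U w * Y w) * F (step (U w * Y w)))%R])%E) /\
     (has_law Q Y (exponential_prob 1) ->
      levy_measure_given_by P (trajectory N) (fun F =>
        lam%:E *
          'E_Q[fun w =>
                 (Y w * expR (U w * Y w) * F (step (U w * Y w)))%R])%E)) /\
  (* (c1) *)
  (forall a : {nonneg R},
     0 < a%:num ->
     [/\ eq_law (conditional P [set w | N a w = 0%N]) (trajectory N)
           P (after N a),
         decomposition P N a P (after N a) (stopped N a),
         (forall (d' : measure_display) (T' : measurableType d')
             (Q : probability T' R) (M L : T' -> paths {nonneg R} R),
            decomposition P N a Q M L ->
            eq_law Q L P (stopped N a) /\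
            levy_measure_given_by Q L (fun F =>
              lam%:E * \int[lebesgue_measure]_(s in `[0%R, a%:num])
                         (F (step s))%:E)%E) &
         (forall (d' : measure_display) (T' : measurableType d')
             (Q : probability T' R) (M : T' -> paths {nonneg R} R),
            conditioned P N a Q M ->
            levy_measure_given_by Q M (fun F =>
              lam%:E * \int[lebesgue_measure]_(s in `[a%:num, +oo[)
                         (F (step s))%:E)%E)]).
Proof.
split; first by move=> a U a0 UE UN; exact: (size_biased_poisson lam_gt0 ppN).
split.
  move=> d' T' Q U Y UE UY; split.
    move=> Y0 suppY _ h.
    have tail_gt0 x : 0 < fine (Q [set w | x <= Y w]).
      by rewrite -lte_fin fineK ?fin_num_tail// law_support_tail.
    apply: (poisson_levy_measure_size_biased lam_gt0 ppN UE UY Y0 (g := h)).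
    - apply: nondecreasing_measurable => // s t st.
      by rewrite /h lef_pV2 ?posrE ?tail_gt0// tail_nonincreasing.
    - by move=> s; rewrite invr_ge0 ltW// tail_gt0.
    - by move=> s _; rewrite invrK fineK// fin_num_tail.
    - by move=> s _; rewrite invr_neq0// gt_eqF// tail_gt0.
  move=> YE; apply: (poisson_levy_measure_size_biased lam_gt0 ppN UE UY
    (exponential_ge0 YE) (g := expR)).
  - exact: measurable_expR.
  - by move=> s; exact: expR_ge0.
  - by move=> s s0; exact: exponential_tail.
  - by move=> s _; rewrite gt_eqF// expR_gt0.
move=> a a0; split.
- exact: (conditional_eq_law_after ppN).
- split.
  + split; first exact: (measurable_after N a).
    by move=> n t B mB; rewrite (conditional_eq_law_after ppN).
  + exact: (measurable_stopped N a).
  + exact: (stopped_infinitely_divisible a lam_gt0 ppN).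
  + exact: (after_stopped_indep ppN a).
  + move=> n t B mB; congr (P (_ @^-1` B)); apply/funext => w.
    by rewrite /fdd (after_stoppedE ppN a).
- move=> d' T' Q M L dec; have [_ mL _ _ _] := dec.
  have LE c := poisson_decomposition_laplace ppN a0 dec (c := c).
  split; first exact: (laplace_eq_law mL (measurable_stopped N a) LE).
  apply: (step_levy_measure_given_by (l := NngNum (ltW lam_gt0)) mL) => // c c0.
  by rewrite unlock LE// (stopped_laplace lam_gt0 ppN).
- move=> d' T' Q M [mM eqM].
  apply: (step_levy_measure_given_by (l := NngNum (ltW lam_gt0)) mM) => // c c0.
  rewrite unlock -(after_laplace lam_gt0 ppN a c0).
  apply: (eq_law_laplace mM (measurable_after N a)) => n t B mB.
  by rewrite eqM// (conditional_eq_law_after ppN).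
Qed.
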